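(* Fix $T>0$ and let $$\Omega=\{q=(x,y)\in H^1([0,T],\mathbb R^2): y(0)=0,\ y(T)=0,\ x(0)\ge 0,\ x(T)\le 0\},$$ $$\mathcal A(q)=\int_0^T\Big(\frac12|\dot q(t)|^2+\frac{1}{|q(t)|}+x(t)\Big)\,dt .$$ Then every global minimizer of $\mathcal A$ on $\Omega$ is half of a collision–ejection orbit of the planar Stark problem $\ddot x=-x/r^3+1$, $\ddot y=-y/r^3$ ($r=\sqrt{x^2+y^2}$) lying on the negative $x$-axis, i.e. the corresponding collision–ejection orbit has period $2T$.
   Context: A collision–ejection orbit on the negative $x$-axis is a solution moving on $\{(x,0):x<0\}$ which collides with the origin and (after regularization) is ejected back along the same half-line; it is periodic. *)

(* Defs.v *)
From HB Require Import structures.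
From mathcomp Require Import all_boot all_order all_algebra.
From mathcomp Require Import all_classical all_reals all_analysis.
Set Implicit Arguments. Unset Strict Implicit. Unset Printing Implicit Defensive.
Import Order.TTheory GRing.Theory Num.Theory.
Import numFieldNormedType.Exports.
Local Open Scope classical_set_scope.
Local Open Scope ring_scope.

(* H^1([0,T], R) for a real-valued component: f is (the absolutely continuous
   representative) f(t) = f(0) + int_0^t u with u in L^2([0,T]). *)
Definition H1 {R : realType} (T : R) (f : R -> R) : Prop :=
  exists u : R -> R,
    measurable_fun `[0, T]%classic u /\
    (\int[lebesgue_measure]_(t in `[0%R, T]%classic) ((u t) ^+ 2)%:E < +oo)%E /\
    forall t, 0 <= t <= T ->
      f t = f 0 + Rintegral lebesgue_measure `[0, t]%classic u.

Definition Omega {R : realType} (T : R) (x y : R -> R) : Prop :=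
  H1 T x /\ H1 T y /\ y 0 = 0 /\ y T = 0 /\ 0 <= x 0 /\ x T <= 0.

Definition stark_lagr {R : realType} (x y : R -> R) (t : R) : \bar R :=
  if (x t == 0) && (y t == 0) then +oo%E
  else ((2^-1 * ((derive1 x t) ^+ 2 + (derive1 y t) ^+ 2)
         + (Num.sqrt (x t ^+ 2 + y t ^+ 2))^-1 + x t)%:E).

Definition action {R : realType} (T : R) (x y : R -> R) : \bar R :=
  \int[lebesgue_measure]_(t in `[0%R, T]%classic) stark_lagr x y t.

Definition reflect_ext {R : realType} (T : R) (f : R -> R) (t : R) : R :=
  if t <= T then f t else f (2 * T - t).

(* One period [0,P] of a collision-ejection orbit of the planar Stark problem
   x'' = -x/r^3 + 1, y'' = -y/r^3 lying on the negative x-axis: it starts and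
   ends at the origin (collision), is continuous on [0,P], and on ]0,P[ it lies
   on {(x,0) : x < 0} and is a classical (C^2-type) solution. *)
Definition collision_ejection_negx {R : realType} (P : R) (X Y : R -> R) : Prop :=
  X 0 = 0 /\ Y 0 = 0 /\ X P = 0 /\ Y P = 0 /\
      {within `[0, P]%classic, continuous X} /\
      {within `[0, P]%classic, continuous Y} /\
      forall t, 0 < t < P ->
        let r := Num.sqrt (X t ^+ 2 + Y t ^+ 2) in
        Y t = 0 /\ X t < 0 /\
        derivable X t 1 /\ derivable (derive1 X) t 1 /\
        derivable Y t 1 /\ derivable (derive1 Y) t 1 /\
        derive1 (derive1 X) t = - X t / r ^+ 3 + 1 /\
        derive1 (derive1 Y) t = - Y t / r ^+ 3.

(* Main.v *)
Require Import Defs.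
From HB Require Import structures.
From mathcomp Require Import all_boot all_order all_algebra.
From mathcomp Require Import all_classical all_reals all_analysis.
From mathcomp Require Import measurable_realfun ring lra.
Import Order.TTheory GRing.Theory Num.Theory.
Import numFieldNormedType.Exports.
Local Open Scope classical_set_scope.
Local Open Scope ring_scope.
Set Implicit Arguments. Unset Strict Implicit. Unset Printing Implicit Defensive.

(** Let q = (x, y) be a minimizer, r = |q|.

    If q collides at time c, run the part of q before c backwards: the path on
    the negative x-axis whose distance to the origin is the length travelled
    since the collision has the same kinetic energy, is farther from the origin
    up to a measure preserving change of time, and has a smaller integral of x.
    Hence q itself moves monotonically along the negative x-axis from x(0) = 0.

    If q has no collision, it is a classical solution with x'(0) = x'(T) = 0,
    and y does not vanish on ]0, T[: otherwise reflecting y after a zero gives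
    another minimizer, so y' vanishes there too and y = 0. In the parabolic
    coordinates q = (U + i V)^2 and the time tau with d tau = dt / r, the
    equations decouple into U'' = (h/2 + U^2) U, V'' = (h/2 - V^2) V with h the
    energy, and V(0) = 0 = U'(0), U = 0 = V' at the end. Testing against
    cos (k tau) and sin (k tau), k = pi / (2 tau(T)), yields h/2 + k^2 < 0 and
    h/2 + k^2 > 0.

    So q collides, satisfies the Euler-Lagrange equation on ]0, T], and the
    natural condition x'(T) = 0 makes its reflection at T a solution. *)

(** * Integration *)

(** A minimizer is a priori only an H^1 curve whose collision times are unknown, and its action may
    involve [+oo]. The action is therefore split into a real part (kinetic energy and integral of
    [x]) and the integral of [1/r] in [[0, +oo]]. One explicit curve of finite action makes the
    latter finite for a minimizer, and only then can actions be subtracted.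

    The collision case needs no local study of collisions: minimality gives [int (x + r) <= 0],
    whereas [x + r >= 0] everywhere, so the comparison is rigid.

    In the collision-free case the uniform field is what produces the contradiction. For the pure
    Kepler problem both regularized equations reduce to the same linear one, with coefficient [h/2],
    and half turns do exist. The field adds [U^2] to one coefficient and [- V^2] to the other, while
    [U] and [V] must each fit a quarter of an oscillation into the same interval of [tau]. *)

Section integration.
Context {R : realType}.
Local Notation mu := (@lebesgue_measure R).

Import HBNNSimple.

(* For non-measurable [f] and [g]: [derive1] of an H^1 function is only known
   up to a null set, and the Borel sigma-algebra is not complete. *)
Lemma ge0_le_integral_off_null d (X : measurableType d)
    (m : {measure set X -> \bar R}) (D N : set X) (f g : X -> \bar R) :
  measurable N -> m N = 0%E ->
  (forall x, D x -> 0 <= f x)%E -> (forall x, D x -> 0 <= g x)%E ->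
  (forall x, D x -> ~ N x -> f x <= g x)%E ->
  (\int[m]_(x in D) f x <= \int[m]_(x in D) g x)%E.
Proof.
move=> mN N0 f0 g0 fg; rewrite !ge0_integralE//.
apply: ge_ereal_sup => _ [h /= hf <-].
have mNC : measurable (~` N) by exact: measurableC.
(* The integral is a supremum over simple functions below the integrand. A simple [h] below [f] is
   cut off on [N]: it is then below [g], and its integral has not changed. *)
apply: le_ereal_sup_tmp; exists (sintegral m (proj_nnsfun h mNC)).
  exists (proj_nnsfun h mNC) => // x; rewrite -(mrestrict h mNC).
  have := hf x; rewrite !patchE; case: ifPn => [/[!inE] Dx|_] hx; last first.
    case: ifPn => // _.
  case: ifPn => [/[!inE] Nx|_]; first exact: le_trans hx (fg _ Dx Nx).
  exact: g0.
rewrite -!integralT_nnsfun (ge0_negligible_integral mN)//; last first.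
- by move=> x _; rewrite lee_fin.
- exact/measurable_EFinP.
rewrite setTD integral_mkcond; apply: ge0_le_integral => //.
- by move=> x _; rewrite patchE; case: ifP => //; rewrite lee_fin.
- by apply/measurable_restrict => //; rewrite setTI; exact/measurable_EFinP/measurable_funTS.
- exact/measurable_EFinP.
- by move=> x _; rewrite -mrestrict !patchE; case: ifP.
Qed.

Lemma integral_off_null d (X : measurableType d)
    (m : {measure set X -> \bar R}) (D N : set X) (f g : X -> \bar R) :
  measurable N -> m N = 0%E ->
  (forall x, D x -> ~ N x -> f x = g x) ->
  (\int[m]_(x in D) f x = \int[m]_(x in D) g x)%E.
Proof.
move=> mN N0 fg; rewrite integralE [RHS]integralE.
by congr (_ - _)%E; apply/eqP; rewrite eq_le; apply/andP; split;
  apply: (ge0_le_integral_off_null mN) => // x Dx Nx;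
  rewrite ?(funeposE, funenegE) fg.
Qed.

(** By uniqueness of Lebesgue measure it is enough to test the intervals []a, b]], whose preimages
    [[c - b, c - a[] have the same length. *)
Lemma lebesgue_measure_reflection (c : R) (A : set R) : measurable A ->
  pushforward mu ((fun t => c - t) : _ -> measurableTypeR R) A = mu A.
Proof.
move=> mA.
have mc : measurable_fun [set: measurableTypeR R]
   ((fun t => c - t) : measurableTypeR R -> measurableTypeR R).
  exact: measurable_funB.
apply/esym.
pose ph := pushforward mu ((fun t => c - t) : measurableTypeR R -> measurableTypeR R).
apply: (@lebesgue_measure_unique R ph) => //= _ [[a b]] _ <-.
rewrite /ph /pushforward.
have -> : ((fun t => c - t) : R -> R) @^-1` `]a, b]%classic = `[c - b, c - a[%classic.
  apply/seteqP; split => t /=; rewrite !in_itv/= => /andP[h1 h2]; apply/andP; split; lra.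
rewrite !lebesgue_measure_itv/= !lte_fin ltrD2l ltrN2.
by case: ifP => // _; rewrite -!EFinD; congr EFin; ring.
Qed.

Lemma ge0_integral_reflection (a b c : R) (f : R -> \bar R) :
  measurable_fun `[c - b, c - a]%classic f ->
  (forall t, t \in `[c - b, c - a] -> (0 <= f t)%E) ->
  (\int[mu]_(t in `[a, b]%classic) f (c - t)%R = \int[mu]_(t in `[(c - b)%R, (c - a)%R]%classic) f t)%E.
Proof.
move=> mf f0.
have mc : measurable_fun [set: measurableTypeR R]
   ((fun t => c - t) : measurableTypeR R -> measurableTypeR R).
  exact: measurable_funB.
have -> : `[a, b]%classic = ((fun t => c - t) : measurableTypeR R -> measurableTypeR R)
    @^-1` `[c - b, c - a]%classic.
  apply/seteqP; split => t /=; rewrite !in_itv/= => /andP[h1 h2]; apply/andP; split; lra.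
rewrite -(@ge0_integral_pushforward _ _ _ _ _ _ mc mu _ f)//; last first.
  by move=> t; rewrite inE/=; exact: f0.
apply: eq_measure_integral => A mA _.
exact: lebesgue_measure_reflection.
Qed.

(** Measure preserving change of time behind the rearrangement: it reverses [[0, c]], so that a
    collision at time [c] is moved to time 0, and fixes []c, T]]. The jump at [c] is harmless, since
    only integrals are transported. *)
Definition fold (c t : R) : R := if t <= c then c - t else t.

Lemma fold_itv (c T t : R) : 0 <= c <= T -> 0 <= t <= T -> 0 <= fold c t <= T.
Proof. by move=> /andP[c0 cT] /andP[t0 tT]; rewrite /fold; case: (leP t c) => tc; apply/andP; split; lra. Qed.

Lemma fold_setU (c T : R) : 0 <= c <= T ->
  `[0, T]%classic = `[0, c]%classic `|` `]c, T]%classic.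
Proof.
move=> /andP[c0 cT]; rewrite -itv_bndbnd_setU// bnd_simp//.
Qed.

Lemma measurable_fun_fold d (X : measurableType d) (c T : R) (f : R -> X) :
  0 <= c <= T ->
  measurable_fun `[0, T]%classic f -> measurable_fun `[0, T]%classic (f \o fold c).
Proof.
move=> cT mf; rewrite (fold_setU cT); apply/measurable_funU => //; split.
  apply: (@eq_measurable_fun _ _ _ _ _ (f \o (fun t => c - t))).
    by move=> t; rewrite inE/= in_itv/= /fold => /andP[_ ->].
  apply: (measurable_comp (F := `[0, T]%classic)) => //.
  - move=> _ [t /= + <-]; rewrite !in_itv/= => /andP[? ?].
    by move: cT => /andP[? ?]; apply/andP; split; lra.
  - exact: measurable_funB.
apply: (@eq_measurable_fun _ _ _ _ _ f).
  by move=> t; rewrite inE/= in_itv/= /fold => /andP[ct _]; rewrite leNgt ct.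
apply: measurable_funS mf => //.
by apply: subset_itv; rewrite bnd_simp//; case/andP: cT.
Qed.

Lemma ge0_integral_fold (c T : R) (f : R -> \bar R) : 0 <= c <= T ->
  measurable_fun `[0, T]%classic f -> (forall t, 0 <= t <= T -> (0 <= f t)%E) ->
  (\int[mu]_(t in `[0%R, T]) f (fold c t) = \int[mu]_(t in `[0%R, T]) f t)%E.
Proof.
move=> cT mf f0.
have dj : [disjoint `[0, c]%classic & `]c, T]%classic].
  apply/disj_setPS => t [/=]; rewrite !in_itv/= => /andP[_ tc] /andP[].
  by rewrite ltNge tc.
have splitE (g : R -> \bar R) : measurable_fun `[0, T]%classic g ->
    (forall t, 0 <= t <= T -> (0 <= g t)%E) ->
    (\int[mu]_(t in `[0%R, T]) g t =
     \int[mu]_(t in `[0%R, c]) g t + \int[mu]_(t in `]c, T]) g t)%E.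
  by move=> mg g0; rewrite (fold_setU cT) ge0_integral_setU// -(fold_setU cT).
have -> := splitE _ (measurable_fun_fold cT mf) (fun t tT => f0 _ (fold_itv cT tT)).
have -> := splitE _ mf f0.
congr (_ + _)%E.
  under eq_integral => t.
    rewrite inE/= in_itv/= => /andP[_ tc]; rewrite /fold tc; over.
  have h := @ge0_integral_reflection 0 c c f; rewrite subrr subr0 in h.
  case/andP: cT => c0 cT; apply: h.
    by apply: measurable_funS mf => //; apply: subset_itv; rewrite bnd_simp.
  by move=> t; rewrite in_itv/= => /andP[t0 tc]; apply: f0; rewrite t0 (le_trans tc).
apply: eq_integral => t; rewrite inE/= in_itv/= => /andP[ct _].
by rewrite /fold leNgt ct.
Qed.

End integration.

(** * H^1 functions *)

Section H1_theory.
Context {R : realType}.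
Local Notation mu := (@lebesgue_measure R).
Implicit Types (T : R) (f g u v : R -> R).

(** [H1] with the weak derivative exposed. All estimates use [u]; the [derive1] of the action is
    traded for it once, in [actionE]. *)
Definition H1_deriv T f u : Prop :=
  measurable_fun `[0, T]%classic u /\
  (\int[mu]_(t in `[0%R, T]%classic) ((u t) ^+ 2)%:E < +oo)%E /\
  forall t, 0 <= t <= T -> f t = f 0 + Rintegral mu `[0, t]%classic u.

Definition L2 T u : Prop := measurable_fun `[0, T]%classic u /\
  mu.-integrable `[0, T]%classic (EFin \o (fun t => u t ^+ 2)).

Lemma L2P T u : L2 T u <-> measurable_fun `[0, T]%classic u /\
  (\int[mu]_(t in `[0%R, T]%classic) ((u t) ^+ 2)%:E < +oo)%E.
Proof.
split=> -[mu_ h]; split=> //.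
  by move/integrableP : h => [_]; under eq_integral do rewrite /= ger0_norm ?sqr_ge0//.
apply/integrableP; split.
  exact/measurable_EFinP/measurable_funX.
by under eq_integral do rewrite /= ger0_norm ?sqr_ge0//.
Qed.

Lemma integrable_add (D : set (measurableTypeR R)) f g : measurable D ->
  mu.-integrable D (EFin \o f) -> mu.-integrable D (EFin \o g) ->
  mu.-integrable D (EFin \o (fun t => f t + g t)).
Proof. by move=> mD If Ig; apply: eq_integrable (integrableD mD If Ig) => //. Qed.

Lemma integrable_scale (D : set (measurableTypeR R)) (k : R) f : measurable D ->
  mu.-integrable D (EFin \o f) -> mu.-integrable D (EFin \o (fun t => k * f t)).
Proof. by move=> mD If; apply: eq_integrable (integrableZl mD k If) => //. Qed.

Lemma integrable_cst_itv (a b k : R) : mu.-integrable `[a, b]%classic (EFin \o cst k).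
Proof.
apply: continuous_compact_integrable; first exact: segment_compact.
exact/continuous_subspaceT/cst_continuous.
Qed.

Lemma L2_mul T u v : L2 T u -> L2 T v ->
  mu.-integrable `[0, T]%classic (EFin \o (fun t => u t * v t)).
Proof.
move=> [mu_ iu] [mv iv].
apply: (@le_integrable _ _ _ mu _ _ _ (EFin \o (fun t => u t ^+ 2 + v t ^+ 2))) => //.
- exact/measurable_EFinP/measurable_funM.
- move=> t _ /=; rewrite lee_fin (ger0_norm (addr_ge0 _ _)) ?sqr_ge0//.
  rewrite normrM -(real_normK (num_real (u t))) -(real_normK (num_real (v t))).
  have := sqr_ge0 (`|u t| - `|v t|); have := normr_ge0 (u t); have := normr_ge0 (v t).
  nra.
- exact: integrable_add.
Qed.

Lemma L2_cst T k : L2 T (cst k).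
Proof. by split; [exact: measurable_cst|exact: (integrable_cst_itv 0 T (k ^+ 2))]. Qed.

Lemma L2_integrable T u : L2 T u -> mu.-integrable `[0, T]%classic (EFin \o u).
Proof.
move=> /L2_mul /(_ (L2_cst T 1)); apply: eq_integrable => // t _ /=.
by rewrite mulr1.
Qed.

Lemma L2_sub T u v : measurable_fun `[0, T]%classic u -> L2 T v ->
  (forall t, t \in `[0, T] -> `|u t| <= `|v t|) -> L2 T u.
Proof.
move=> mu_ [mv iv] uv; split => //.
apply: le_integrable iv => //; first exact/measurable_EFinP/measurable_funX.
move=> t tT /=; rewrite lee_fin !normrX lerXn2r ?nnegrE//; exact: uv.
Qed.

Lemma L2D T u v : L2 T u -> L2 T v -> L2 T (fun t => u t + v t).
Proof.
move=> Lu Lv; split; first by apply: measurable_funD; [case: Lu|case: Lv].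
have h : mu.-integrable `[0, T]%classic
    (EFin \o (fun t => u t ^+ 2 + (u t * v t + u t * v t) + v t ^+ 2)).
  apply: integrable_add => //; last by case: Lv.
  apply: integrable_add => //; first by case: Lu.
  by apply: integrable_add => //; exact: L2_mul.
by apply: eq_integrable h => // t _ /=; congr EFin; ring.
Qed.

Lemma L2Z T k u : L2 T u -> L2 T (fun t => k * u t).
Proof.
move=> [mu_ iu]; split; first exact: measurable_funM.
have h := integrable_scale (k ^+ 2) (measurable_itv `[0, T]) iu.
by apply: eq_integrable h => // t _ /=; rewrite exprMn.
Qed.

Lemma H1_derivP T f u : H1_deriv T f u <-> L2 T u /\
  forall t, 0 <= t <= T -> f t = f 0 + Rintegral mu `[0, t]%classic u.
Proof.
split=> [[mu_ [iu fE]]|[/L2P[mu_ iu] fE]]; last by [].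
by split => //; apply/L2P.
Qed.

Lemma integrable_subitv T u (s t : R) : mu.-integrable `[0, T]%classic (EFin \o u) ->
  0 <= s -> t <= T -> mu.-integrable `[s, t]%classic (EFin \o u).
Proof.
move=> iu s0 tT; apply: integrableS iu => //.
by apply: subset_itv; rewrite bnd_simp.
Qed.

Lemma Rintegral_split u (a b c : R) : mu.-integrable `[a, c]%classic (EFin \o u) ->
  a <= b <= c ->
  Rintegral mu `[a, c]%classic u =
  Rintegral mu `[a, b]%classic u + Rintegral mu `[b, c]%classic u.
Proof.
move=> iu /andP[ab bc].
have := @Rintegral_itvB R u (BLeft a) (BRight c) b iu.
rewrite !bnd_simp => /(_ ab bc) => h.
rewrite -(@Rintegral_itv_obnd_cbnd _ b (BRight c)); last first.
  by apply: integrableS iu => //; apply: subset_itv; rewrite bnd_simp.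
by rewrite -h addrC subrK.
Qed.

Lemma H1_deriv_increment T f u (s t : R) : H1_deriv T f u -> 0 <= s <= t -> t <= T ->
  f t = f s + Rintegral mu `[s, t]%classic u.
Proof.
move=> /H1_derivP[Lu fE] /andP[s0 st] tT.
rewrite (fE t) ?(fE s) ?s0 ?(le_trans st) ?(le_trans s0)//.
rewrite (@Rintegral_split _ 0 s t) ?s0//; last first.
  exact: integrable_subitv (L2_integrable Lu) _ _.
by rewrite addrA.
Qed.

Lemma H1_deriv_continuous T f u : 0 < T -> H1_deriv T f u ->
  {within `[0, T], continuous f}.
Proof.
move=> T0 /H1_derivP[Lu fE].
have cI := parameterized_integral_continuous (ltW T0) (L2_integrable Lu).
have : {within `[0, T], continuous (fun t => f 0 + parameterized_integral mu 0 t u)}.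
  move=> t; apply: cvgD; first exact: cvg_cst.
  exact: cI.
apply: subspace_eq_continuous => t; rewrite inE/= => tT.
by rewrite in_itv/= in tT; exact/esym/fE.
Qed.

Lemma H1_derivD T f g u v (k : R) : H1_deriv T f u -> H1_deriv T g v ->
  H1_deriv T (fun t => f t + k * g t) (fun t => u t + k * v t).
Proof.
move=> /H1_derivP[Lu fE] /H1_derivP[Lv gE]; apply/H1_derivP.
split; first exact/L2D/L2Z.
move=> t /[dup] tT /andP[t0 tT'].
have iu : mu.-integrable `[0, t]%classic (EFin \o u).
  exact: integrable_subitv (L2_integrable Lu) _ _.
have iv : mu.-integrable `[0, t]%classic (EFin \o v).
  exact: integrable_subitv (L2_integrable Lv) _ _.
rewrite RintegralD//; last first.
  exact: integrable_subitv (L2_integrable (L2Z k Lv)) _ _.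
by rewrite RintegralZl// (fE t)// (gE t)//; ring.
Qed.

Lemma H1_deriv_cst T (k : R) : H1_deriv T (cst k) (cst 0).
Proof.
apply/H1_derivP; split; first exact: L2_cst.
by move=> t _; rewrite /cst Rintegral_cst//= mul0r addr0.
Qed.

Lemma H1_deriv_primitive T f u : L2 T u ->
  (forall t, f t = Rintegral mu `[0, t]%classic u) -> H1_deriv T f u.
Proof.
move=> Lu fE; apply/H1_derivP; split => // t _.
by rewrite !fE set_itv1 Rintegral_set1 add0r.
Qed.

(** Lebesgue differentiation, applied to [u] extended by zero so as to be integrable on the whole
    line. *)
Lemma H1_deriv_ae_derive1 T f u : 0 < T -> H1_deriv T f u ->
  exists N, [/\ measurable N, mu N = 0%E &
    forall t, t \in `[0, T] -> ~ N t -> derive1 f t = u t].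
Proof.
move=> T0 /H1_derivP[Lu fE].
pose U := u \_ `[0, T]%classic.
have iU : mu.-integrable setT (EFin \o U).
  have /integrable_mkcond := L2_integrable Lu.
  move=> /(_ (measurable_itv _)); apply: eq_integrable => // t _ /=.
  by rewrite /U !patchE; case: ifP.
have locU : locally_integrable setT U.
  exact: integrable_locally (L2_integrable Lu).
have iUy y : mu.-integrable [set` Interval (BLeft 0) (BRight y)] (EFin \o U).
  exact: integrableS iU.
have [N [mN N0 NS]] := FTC1 iUy locU.
(* The endpoints are thrown into the null set because [derive1] is two-sided and [f] is arbitrary
   outside [[0, T]]. *)
exists (N `|` [set 0; T]); split.
- by apply: measurableU => //; exact: measurableU.
- apply: null_set_setU => //; first exact: measurableU.
  by apply: null_set_setU => //; exact: lebesgue_measure_set1.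
move=> t; rewrite in_itv/= => /andP[t0 tT] /not_orP[Nt /not_orP[/= tn0 tnT]].
have {}t0 : 0 < t by rewrite lt_neqAle t0 andbT eq_sym; apply/eqP.
have {}tT : t < T by rewrite lt_neqAle tT andbT; apply/eqP.
pose F x := Rintegral mu `[0, x]%classic U.
have [dU dUE] : derivable F t 1 /\ derive1 F t = U t.
  apply: contrapT => h; apply: Nt; apply: NS => /= h'; apply: h.
  by apply: h'; rewrite lte_fin.
have -> : u t = U t by rewrite /U patchE ifT// inE/= in_itv/= !ltW.
rewrite -dUE !derive1E.
have : {near t, (fun x => f 0 + F x) =1 f}.
  near=> s.
  have s0 : 0 < s by near: s; exact: lt_nbhsr.
  have sT : s < T by near: s; exact: lt_nbhsl.
  rewrite (fE s) ?ltW// /F; congr (_ + _); apply: eq_Rintegral => z.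
  rewrite inE/= in_itv/= => /andP[z0 zs].
  by rewrite ifT// inE/= in_itv/= z0 (le_trans zs)// ltW.
move=> /near_eq_derive <-.
by rewrite deriveD// derive_cst add0r.
Unshelve. all: by end_near. Qed.

End H1_theory.

(** * The action and its minimizers *)

Section action_theory.
Context {R : realType}.
Local Notation mu := (@lebesgue_measure R).
Implicit Types (T : R) (x y u v : R -> R).

Lemma measurable_fun_inv : measurable_fun [set: R] (@GRing.inv R).
Proof.
have -> : @GRing.inv R = (fun r => if r == 0 then 0 else r^-1).
  by apply/funext => r; case: eqP => // ->; rewrite invr0.
apply: measurable_fun_if => //; first exact: measurable_fun_eqr.
apply: open_continuous_measurable_fun.
  rewrite setTI (_ : _ @^-1` _ = [set r | r != 0]); first exact: open_neq.
  by apply/seteqP; split => r /=; case: eqP.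
by move=> r; rewrite inE/= => -[_ /negbT r0]; exact: inv_continuous.
Qed.

Lemma measurable_fun_sqrt : measurable_fun [set: R] (@Num.sqrt R).
Proof. by apply: continuous_measurable_fun; exact: sqrt_continuous. Qed.

Definition radius x y (t : R) : R := Num.sqrt (x t ^+ 2 + y t ^+ 2).

(** Collisions get the value [+oo] explicitly: with the convention [0^-1 = 0] they would cost
    nothing. *)
Definition inv_radius x y (t : R) : \bar R :=
  if (x t == 0) && (y t == 0) then +oo%E else (radius x y t)^-1%:E.

Definition kinetic T u v : R :=
  Rintegral mu `[0, T]%classic (fun t => 2^-1 * (u t ^+ 2 + v t ^+ 2)).

Lemma radius_ge0 x y t : 0 <= radius x y t.
Proof. exact: sqrtr_ge0. Qed.

Lemma sqr_radius x y t : radius x y t ^+ 2 = x t ^+ 2 + y t ^+ 2.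
Proof. by rewrite sqr_sqrtr// addr_ge0 ?sqr_ge0. Qed.

Lemma radius_eq0 x y t : (radius x y t == 0) = (x t == 0) && (y t == 0).
Proof.
by rewrite -sqrf_eq0 sqr_radius paddr_eq0 ?sqr_ge0// !sqrf_eq0.
Qed.

Lemma inv_radius_ge0 x y t : (0 <= inv_radius x y t)%E.
Proof.
rewrite /inv_radius; case: ifP => // _; rewrite lee_fin invr_ge0.
exact: radius_ge0.
Qed.

Lemma le_inv_radius x y x' y' t s : radius x' y' t <= radius x y s ->
  (inv_radius x y s <= inv_radius x' y' t)%E.
Proof.
move=> rr; rewrite /inv_radius; case: ifPn => [xy0|_].
  move: xy0; rewrite -radius_eq0 => /eqP r0.
  have : radius x' y' t == 0 by rewrite eq_le radius_ge0 -r0 rr.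
  by rewrite radius_eq0 => ->.
case: ifPn => [_|]; first by rewrite leey.
rewrite -radius_eq0 => r'0; rewrite lee_fin lef_pV2// posrE lt_neqAle radius_ge0 andbT eq_sym//.
apply: contraNneq r'0 => r0; by rewrite eq_le radius_ge0 -r0 rr.
Qed.

Lemma measurable_inv_radius D x y : measurable D -> measurable_fun D x -> measurable_fun D y ->
  measurable_fun D (inv_radius x y).
Proof.
move=> mD mx my.
apply: measurable_fun_if => //.
- by apply: measurable_and; apply: measurable_fun_eqr.
- apply: measurable_funS (_ : measurable_fun D _) => //.
  apply/measurable_EFinP.
  apply: (measurableT_comp measurable_fun_inv).
  apply: (measurableT_comp measurable_fun_sqrt).
  by apply: measurable_funD; apply: measurable_funX.
Qed.

Lemma integral_add_ge0 (D : set (measurableTypeR R)) (g : R -> R) (h : R -> \bar R) :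
  measurable D -> mu.-integrable D (EFin \o g) -> measurable_fun D h ->
  (forall t, D t -> 0 <= h t)%E -> (\int[mu]_(t in D) h t < +oo)%E ->
  (\int[mu]_(t in D) ((g t)%:E + h t) = (Rintegral mu D g)%:E + \int[mu]_(t in D) h t)%E.
Proof.
move=> mD ig mh h0 hoo.
have ih : mu.-integrable D h.
  apply/integrableP; split => //; under eq_integral => t tD.
    by rewrite gee0_abs; [over|apply: h0; rewrite inE in tD].
  done.
rewrite integralD//; congr (_ + _)%E.
by rewrite /Rintegral fineK// integrable_fin_num.
Qed.

(** The negative part of [g + h] is at most [|g|], so its integral is finite and that of the
    positive part is finite too; then [h] is at most this positive part plus [|g|]. *)
Lemma integral_add_lty (D : set (measurableTypeR R)) (g : R -> R) (h : R -> \bar R) :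
  measurable D -> mu.-integrable D (EFin \o g) -> measurable_fun D h ->
  (forall t, D t -> 0 <= h t)%E ->
  (\int[mu]_(t in D) ((g t)%:E + h t) < +oo)%E -> (\int[mu]_(t in D) h t < +oo)%E.
Proof.
move=> mD ig mh h0.
pose f t := ((g t)%:E + h t)%E.
have mg : measurable_fun D (EFin \o g) by exact: measurable_int ig.
have mf : measurable_fun D f by exact: emeasurable_funD.
have ing : (\int[mu]_(t in D) `|(g t)%:E| < +oo)%E by move/integrableP : ig => [].
have mag : measurable_fun D (fun t => `|(g t)%:E|)%E by exact: measurableT_comp.
rewrite -/(f _) integralE => fP.
have fN : (\int[mu]_(t in D) f^\- t < +oo)%E.
  apply: le_lt_trans ing; apply: ge0_le_integral => //.
  - exact: measurable_funeneg.
  - move=> t Dt; rewrite funenegE ge_max; apply/andP; split; last exact: abse_ge0.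
    rewrite leeNl (le_trans _ (leeDl _ (h0 _ Dt)))// leeNl.
    by rewrite -EFinN lee_fin -normrN ler_norm.
have fPoo : (\int[mu]_(t in D) f^\+ t < +oo)%E.
  move: fP fN; have : (0 <= \int[mu]_(t in D) f^\- t)%E by exact: integral_ge0.
  case: (\int[mu]_(t in D) f^\+ t)%E => [r| |]; rewrite ?ltry ?ltNyr//.
  by case: (\int[mu]_(t in D) f^\- t)%E => [r| |].
apply: (@le_lt_trans _ _ (\int[mu]_(t in D) (f^\+ t + `|(g t)%:E|))%E).
  apply: ge0_le_integral => //.
  - by apply: emeasurable_funD => //; exact: measurable_funepos.
  - move=> t Dt; apply: (@le_trans _ _ (f t + `|(g t)%:E|)%E); last first.
      by rewrite leeD2r// funeposE le_max lexx.
    rewrite /f; have := h0 _ Dt; case: (h t) => [r| |]//=.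
    by rewrite !lee_fin => r0; have := ler_norm (- g t); rewrite normrN; lra.
rewrite ge0_integralD//; last exact: measurable_funepos.
by rewrite lte_add_pinfty.
Qed.

Section decomposition.
Variables (T : R) (x y u v : R -> R).
Hypothesis T0 : 0 < T.
Hypothesis xu : H1_deriv T x u.
Hypothesis yv : H1_deriv T y v.

Lemma H1_deriv_measurable f a : H1_deriv T f a -> measurable_fun `[0, T]%classic f.
Proof.
by move=> /(H1_deriv_continuous T0) cf; apply: subspace_continuous_measurable_fun.
Qed.

Lemma H1_deriv_integrable f a : H1_deriv T f a ->
  mu.-integrable `[0, T]%classic (EFin \o f).
Proof.
move=> /(H1_deriv_continuous T0) cf.
by apply: continuous_compact_integrable => //; exact: segment_compact.
Qed.

Lemma kinetic_integrable : mu.-integrable `[0, T]%classic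
  (EFin \o (fun t => 2^-1 * (u t ^+ 2 + v t ^+ 2))).
Proof.
have [[_ iu] _] := (H1_derivP _ _ _).1 xu.
have [[_ iv] _] := (H1_derivP _ _ _).1 yv.
by apply: integrable_scale => //; exact: integrable_add.
Qed.

Lemma lagr_integrable : mu.-integrable `[0, T]%classic
  (EFin \o (fun t => 2^-1 * (u t ^+ 2 + v t ^+ 2) + x t)).
Proof.
by apply: integrable_add => //; [exact: kinetic_integrable|exact: H1_deriv_integrable xu].
Qed.

Lemma measurable_inv_radius_itv : measurable_fun `[0, T]%classic (inv_radius x y).
Proof.
by apply: measurable_inv_radius => //; [exact: H1_deriv_measurable xu|exact: H1_deriv_measurable yv].
Qed.

Lemma actionE : action T x y = (\int[mu]_(t in `[0%R, T])
  ((2^-1 * (u t ^+ 2 + v t ^+ 2) + x t)%:E + inv_radius x y t))%E.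
Proof.
have [N1 [mN1 N10 xN]] := H1_deriv_ae_derive1 T0 xu.
have [N2 [mN2 N20 yN]] := H1_deriv_ae_derive1 T0 yv.
apply: (@integral_off_null _ _ _ _ _ (N1 `|` N2)).
- exact: measurableU.
- exact: null_set_setU.
- move=> t /= tT /not_orP[n1 n2].
  rewrite /stark_lagr /inv_radius; case: ifP => _; first by rewrite addey.
  by rewrite xN// yN// -EFinD /radius; congr EFin; ring.
Qed.

Lemma action_fin : (\int[mu]_(t in `[0%R, T]) inv_radius x y t < +oo)%E ->
  action T x y = ((kinetic T u v + Rintegral mu `[0, T]%classic x)%:E
    + \int[mu]_(t in `[0%R, T]) inv_radius x y t)%E.
Proof.
move=> Noo; rewrite actionE integral_add_ge0//.
- rewrite RintegralD//; first exact: kinetic_integrable.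
  exact: H1_deriv_integrable xu.
- exact: lagr_integrable.
- exact: measurable_inv_radius_itv.
- by move=> t _; exact: inv_radius_ge0.
Qed.

Lemma action_lty : (action T x y < +oo)%E ->
  (\int[mu]_(t in `[0%R, T]) inv_radius x y t < +oo)%E.
Proof.
rewrite actionE; apply: integral_add_lty => //.
- exact: lagr_integrable.
- exact: measurable_inv_radius_itv.
- by move=> t _; exact: inv_radius_ge0.
Qed.

End decomposition.

End action_theory.

(** * Comparison of a minimizer with competitors *)

Section minimizers.
Context {R : realType}.
Local Notation mu := (@lebesgue_measure R).
Implicit Types (T : R) (x y u v : R -> R).

Lemma radius_continuous (A : set R) x y :
  {within A, continuous x} -> {within A, continuous y} ->
  {within A, continuous (radius x y)}.
Proof.
move=> cx cy t; apply: continuous_comp; last exact: sqrt_continuous.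
apply: cvgD; apply: (@continuous_comp _ _ _ _ (fun z : R => z ^+ 2));
  [exact: cx|exact: exprn_continuous|exact: cy|exact: exprn_continuous].
Qed.

Lemma radius_lower_bound (a b : R) x y : a <= b ->
  {within `[a, b], continuous x} -> {within `[a, b], continuous y} ->
  (forall t, a <= t <= b -> radius x y t != 0) ->
  exists2 m : R, 0 < m & forall t, a <= t <= b -> m <= radius x y t.
Proof.
move=> ab cx cy r0.
have [c cab cmin] := EVT_min ab (radius_continuous cx cy).
exists (radius x y c).
  by rewrite lt_neqAle radius_ge0 andbT eq_sym r0// -in_itv.
by move=> t tab; apply: cmin; rewrite in_itv.
Qed.

Lemma FTC_Rintegral (f g : R -> R) (a b : R) : a <= b ->
  (forall t : R, a <= t <= b -> is_derive t 1 f (g t)) -> continuous g ->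
  Rintegral mu `[a, b]%classic g = f b - f a.
Proof.
rewrite le_eqVlt => /predU1P[->|ab] df cg.
  by rewrite set_itv1 Rintegral_set1 subrr.
have cf t : a <= t <= b -> {for t, continuous f}.
  by move=> /df [dft _]; exact/differentiable_continuous/derivable1_diffP.
rewrite /Rintegral (@continuous_FTC2 _ g f)//.
- exact/continuous_subspaceT.
- split.
  + by move=> t; rewrite in_itv/= => /andP[at_ tb]; have [] := df t; rewrite ?ltW.
  + by apply/cvg_at_right_filter; apply: cf; rewrite lexx ltW.
  + by apply/cvg_at_left_filter; apply: cf; rewrite lexx ltW.
- move=> t; rewrite in_itv/= => /andP[at_ tb]; rewrite derive1E.
  by apply: derive_val; apply: df; rewrite !ltW.
Qed.

Lemma continuous_L2 T (g : R -> R) : continuous g -> L2 T g.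
Proof.
move=> cg; split.
  by apply: subspace_continuous_measurable_fun => //; exact/continuous_subspaceT.
apply: continuous_compact_integrable; first exact: segment_compact.
apply/continuous_subspaceT => t.
by apply: (@continuous_comp _ _ _ _ (fun z : R => z ^+ 2)); [exact: cg|exact: exprn_continuous].
Qed.

Lemma H1_deriv_C1 T (f g : R -> R) : (forall t : R, is_derive t 1 f (g t)) -> continuous g ->
  H1_deriv T f g.
Proof.
move=> df cg; apply/H1_derivP; split; first exact: continuous_L2.
move=> t /andP[t0 _]; rewrite (@FTC_Rintegral f g)//; first by rewrite addrC subrK.
Qed.

Lemma inv_radius_lty T x y (m : R) : 0 < T -> 0 < m ->
  measurable_fun `[0, T]%classic (inv_radius x y) ->
  (forall t, 0 <= t <= T -> m <= radius x y t) ->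
  (\int[mu]_(t in `[0%R, T]) inv_radius x y t < +oo)%E.
Proof.
move=> T0 m0 mr mlt.
apply: (@le_lt_trans _ _ (\int[mu]_(t in `[0%R, T]) (cst m^-1%:E t))%E).
  apply: ge0_le_integral => //.
  - by move=> t _; exact: inv_radius_ge0.
  - move=> t /=; rewrite in_itv/= => /mlt mt.
    rewrite /inv_radius -radius_eq0 gt_eqF ?(lt_le_trans m0)//.
    by rewrite lee_fin lef_pV2// posrE// (lt_le_trans m0).
rewrite integral_cst//= lebesgue_measure_itv/= lte_fin T0 -EFinD -EFinM.
exact: ltry.
Qed.

Definition minimizer T x y := Omega T x y /\
  forall x' y' : R -> R, Omega T x' y' -> (action T x y <= action T x' y')%E.

(** A parabolic arc from the positive to the negative half-axis: [x] vanishes only at [T / 2], where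
    [y] is positive. It serves to show that [1/r] is integrable along any minimizer. *)
Lemma exists_finite_action T : 0 < T ->
  exists x y, Omega T x y /\ (action T x y < +oo)%E.
Proof.
move=> T0.
pose x t : R := 1 - 2 / T * t; pose y t : R := t * (T - t).
pose u (t : R) : R := - (2 / T); pose v t : R := T - 2 * t.
have Tn0 : T != 0 by rewrite gt_eqF.
have xu : H1_deriv T x u.
  apply: H1_deriv_C1; last exact: cst_continuous.
  by move=> t; rewrite /x /u; apply: is_derive_eq; rewrite /GRing.scale/=; ring.
have yv : H1_deriv T y v.
  apply: H1_deriv_C1.
    move=> t; rewrite /y /v; apply: is_derive_eq.
    by rewrite /GRing.scale/=; ring.
  move=> t; apply: cvgB; first exact: cvg_cst.
  by apply: cvgM; [exact: cvg_cst|exact: cvg_id].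
have [m m0 mr] : exists2 m : R, 0 < m & forall t, 0 <= t <= T -> m <= radius x y t.
  apply: radius_lower_bound; first exact: ltW.
  - exact: H1_deriv_continuous xu.
  - exact: H1_deriv_continuous yv.
  move=> t _; rewrite radius_eq0; apply/negP => /andP[/eqP x0].
  have tE : t = T / 2.
    have -> : t = T / 2 * (2 / T * t) by field.
    by move: x0; rewrite /x => /eqP; rewrite subr_eq0 => /eqP <-; rewrite mulr1.
  rewrite /y tE mulf_eq0 => /orP[|].
    by rewrite mulf_eq0 invr_eq0 pnatr_eq0/= orbF (negbTE Tn0).
  by rewrite gt_eqF//; lra.
exists x, y; split.
  split; first by exists u.
  split; first by exists v.
  rewrite /y /x; split; first by rewrite mul0r.
  split; first by rewrite subrr mulr0.
  split; first by rewrite mulr0 subr0.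
  by rewrite divfK//; lra.
have Noo := inv_radius_lty T0 m0 (measurable_inv_radius_itv T0 xu yv) mr.
by rewrite (action_fin T0 xu yv)// lte_add_pinfty// ltry.
Qed.

Lemma minimizer_inv_radius_lty T x y u v : 0 < T -> minimizer T x y ->
  H1_deriv T x u -> H1_deriv T y v ->
  (\int[mu]_(t in `[0%R, T]) inv_radius x y t < +oo)%E.
Proof.
move=> T0 [_ mini] xu yv; apply: (action_lty T0 xu yv).
have [x' [y' [/mini h h']]] := exists_finite_action T0.
exact: le_lt_trans h h'.
Qed.

(** Minimality as an inequality between real numbers: the integral of [1/r] along the minimizer is
    finite, so it can be cancelled on both sides. *)
Lemma minimizer_le T x y u v x' y' u' v' (c : R) : 0 < T -> minimizer T x y ->
  H1_deriv T x u -> H1_deriv T y v ->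
  Omega T x' y' -> H1_deriv T x' u' -> H1_deriv T y' v' ->
  (\int[mu]_(t in `[0%R, T]) inv_radius x' y' t <=
   \int[mu]_(t in `[0%R, T]) inv_radius x y t + c%:E)%E ->
  kinetic T u v + Rintegral mu `[0, T]%classic x <=
  kinetic T u' v' + Rintegral mu `[0, T]%classic x' + c.
Proof.
move=> T0 m xu yv O' xu' yv' Nc.
have Noo := minimizer_inv_radius_lty T0 m xu yv.
have N0 : (0 <= \int[mu]_(t in `[0%R, T]) inv_radius x y t)%E.
  by apply: integral_ge0 => t _; exact: inv_radius_ge0.
have N'oo : (\int[mu]_(t in `[0%R, T]) inv_radius x' y' t < +oo)%E.
  by rewrite (le_lt_trans Nc)// lte_add_pinfty// ltry.
have N'0 : (0 <= \int[mu]_(t in `[0%R, T]) inv_radius x' y' t)%E.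
  by apply: integral_ge0 => t _; exact: inv_radius_ge0.
have := m.2 _ _ O'; rewrite (action_fin T0 xu yv)// (action_fin T0 xu' yv')//.
move: Nc Noo N'oo N0 N'0.
case: (\int[mu]_(t in `[0%R, T]) inv_radius x y t)%E => [n| |]//.
case: (\int[mu]_(t in `[0%R, T]) inv_radius x' y' t)%E => [n'| |]//.
rewrite !lee_fin => h _ _ _ _; lra.
Qed.

Lemma minimizer_le_pointwise T x y u v x' y' u' v' (d : R -> R) : 0 < T -> minimizer T x y ->
  H1_deriv T x u -> H1_deriv T y v ->
  Omega T x' y' -> H1_deriv T x' u' -> H1_deriv T y' v' ->
  mu.-integrable `[0, T]%classic (EFin \o d) ->
  (forall t, 0 <= t <= T -> (inv_radius x' y' t <= inv_radius x y t + (d t)%:E)%E) ->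
  kinetic T u v + Rintegral mu `[0, T]%classic x <=
  kinetic T u' v' + Rintegral mu `[0, T]%classic x' + Rintegral mu `[0, T]%classic d.
Proof.
move=> T0 m xu yv O' xu' yv' id' le_d.
apply: (minimizer_le T0 m xu yv O' xu' yv').
have Noo := minimizer_inv_radius_lty T0 m xu yv.
have mr := measurable_inv_radius_itv T0 xu yv.
rewrite addeC -integral_add_ge0//; last first.
  by move=> t _; exact: inv_radius_ge0.
apply: ge0_le_integral => //.
- by move=> t _; exact: inv_radius_ge0.
- exact: (measurable_inv_radius_itv T0 xu' yv').
- apply: emeasurable_funD => //; exact: measurable_int id'.
- by move=> t /=; rewrite in_itv/= => tT; rewrite addeC; exact: le_d.
Qed.

(** Freezing [f] beyond the endpoints turns continuity within a segment into continuity on the line,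
    the form required to take two-sided derivatives of primitives at the endpoints. *)
Lemma continuous_clamp (a b : R) (f : R -> R) : a <= b ->
  {within `[a, b], continuous f} ->
  continuous (fun t => f (Num.max a (Num.min t b))).
Proof.
move=> ab /subspace_continuousP cf t.
pose c s : R := Num.max a (Num.min s b).
have cc : {for t, continuous c}.
  apply: continuous_max; first exact: cst_continuous.
  by apply: continuous_min; [exact: cvg_id|exact: cst_continuous].
have cab s : `[a, b]%classic (c s).
  by rewrite /c /= in_itv/= le_max lexx/= ge_max ab ge_min lexx orbT.
move=> U /(cf _ (cab t)) /cc h.
have {}h : \forall s \near t, `[a, b]%classic (c s) -> U (f (c s)) := h.
change (\forall s \near t, U (f (c s))).
by apply: filterS h => s; apply; exact: cab.
Qed.

End minimizers.

(** * Minimizers with a collision *)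

Section collision.
Context {R : realType}.
Local Notation mu := (@lebesgue_measure R).
Implicit Types (T : R) (x y u v : R -> R).

Lemma L2_radius T u v : L2 T u -> L2 T v -> L2 T (radius u v).
Proof.
move=> [mu_ iu] [mv iv]; split.
  apply: (measurableT_comp measurable_fun_sqrt).
  by apply: measurable_funD; apply: measurable_funX.
apply: eq_integrable (integrable_add _ iu iv) => //= t _ /=.
by rewrite sqr_radius.
Qed.

(** Cauchy-Schwarz in the plane, by Lagrange's identity with the square of [a * v t - b * u t]. *)
Lemma ler_dot_radius (a b : R) u v t : a * u t + b * v t <= Num.sqrt (a ^+ 2 + b ^+ 2) * radius u v t.
Proof.
rewrite /radius -sqrtrM ?addr_ge0 ?sqr_ge0//.
apply: le_trans (ler_norm _) _; rewrite -sqrtr_sqr ler_wsqrtr//.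
have := sqr_ge0 (a * v t - b * u t); nra.
Qed.

(** The scalar product of the velocity with the chord integrates to the squared chord length
    [L ^+ 2], and by Cauchy-Schwarz to at most [L] times the arc length; divide by [L] when it is
    nonzero. *)
Lemma chord_le_length T x y u v (s t : R) : H1_deriv T x u -> H1_deriv T y v ->
  0 <= s <= t -> t <= T ->
  Num.sqrt ((x t - x s) ^+ 2 + (y t - y s) ^+ 2) <= Rintegral mu `[s, t]%classic (radius u v).
Proof.
move=> xu yv st tT.
have [Lu _] := (H1_derivP _ _ _).1 xu.
have [Lv _] := (H1_derivP _ _ _).1 yv.
have s0 : 0 <= s by case/andP : st.
have iu := integrable_subitv (L2_integrable Lu) s0 tT.
have iv := integrable_subitv (L2_integrable Lv) s0 tT.
have ir := integrable_subitv (L2_integrable (L2_radius Lu Lv)) s0 tT.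
rewrite (H1_deriv_increment xu st tT) (H1_deriv_increment yv st tT) ![_ s + _]addrC !addrK.
set a := Rintegral mu _ u; set b := Rintegral mu _ v.
set L := Num.sqrt _.
have L0 : 0 <= L by exact: sqrtr_ge0.
have LL : L * L <= L * Rintegral mu `[s, t]%classic (radius u v).
  rewrite -expr2 sqr_sqrtr ?addr_ge0 ?sqr_ge0// -RintegralZl//.
  rewrite !expr2 {2}/a {2}/b -!RintegralZl// -RintegralD//; last 2 first.
  - exact: integrable_scale.
  - exact: integrable_scale.
  apply: le_Rintegral => //.
  - by apply: integrable_add => //; exact: integrable_scale.
  - exact: integrable_scale.
  - by move=> z _; exact: ler_dot_radius.
have [L00|Ln0] := eqVneq L 0.
  by rewrite L00; apply: Rintegral_ge0 => z _; exact: radius_ge0.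
by rewrite -(@ler_pM2l _ L)// lt_neqAle eq_sym Ln0.
Qed.

Lemma Rintegral_gt0 T (f : R -> R) (c : R) : 0 < T ->
  {within `[0, T], continuous f} -> (forall t, 0 <= t <= T -> 0 <= f t) ->
  0 <= c <= T -> 0 < f c -> 0 < Rintegral mu `[0, T]%classic f.
Proof.
move=> T0 cf f0 /andP[c0 cT] fc0.
have If : mu.-integrable `[0, T]%classic (EFin \o f).
  by apply: continuous_compact_integrable => //; exact: segment_compact.
have cg := continuous_clamp (ltW T0) cf.
pose g t := f (Num.max 0 (Num.min t T)).
have gE t : 0 <= t <= T -> g t = f t.
  by move=> /andP[t0 tT]; rewrite /g (min_idPl tT) (max_idPr t0).
have gc : f c / 2 < g c by rewrite gE ?c0//; lra.
have : \forall t \near c, f c / 2 < g t by exact: cvgr_gt (cg c) _ gc.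
move=> /nbhs_ballP[e /= e0 he].
(* A neighbourhood of [c] on which [f] is at least [f c / 2], cut to [[0, T]]. It keeps positive
   length even when [c] is an endpoint. *)
pose s := Num.max 0 (c - e / 2); pose t := Num.min T (c + e / 2).
have s0 : 0 <= s by rewrite /s le_max lexx.
have tT : t <= T by rewrite /t ge_min lexx.
have st : s < t by rewrite /s /t gt_max !lt_min; apply/andP; split; apply/andP; split; lra.
have ds : c - e / 2 <= s by rewrite /s le_max lexx orbT.
have dt : t <= c + e / 2 by rewrite /t ge_min lexx orbT.
have fst z : s <= z <= t -> f c / 2 <= f z.
  move=> /andP[sz zt]; rewrite -(gE z); last by apply/andP; split; lra.
  apply/ltW; have := he z; apply; rewrite -ball_normE /ball_/= ltr_distl; apply/andP; split; lra.
have Is := integrable_subitv If s0 tT.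
rewrite (Rintegral_split If (b := s)); last by apply/andP; split; lra.
rewrite (@Rintegral_split R f s t T); last 2 first.
- exact: integrable_subitv If s0 (lexx _).
- by apply/andP; split; lra.
have h1 : 0 <= Rintegral mu `[0, s]%classic f.
  by apply: Rintegral_ge0 => z /=; rewrite in_itv/= => /andP[? ?]; apply: f0; apply/andP; split; lra.
have h2 : 0 <= Rintegral mu `[t, T]%classic f.
  by apply: Rintegral_ge0 => z /=; rewrite in_itv/= => /andP[? ?]; apply: f0; apply/andP; split; lra.
have h3 : f c / 2 * (t - s) <= Rintegral mu `[s, t]%classic f.
  have -> : f c / 2 * (t - s) = Rintegral mu `[s, t]%classic (cst (f c / 2)).
    rewrite Rintegral_cst//= lebesgue_measure_itv/= lte_fin st -EFinD//=.
  apply: le_Rintegral => //; first exact: integrable_cst_itv.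
have h4 : 0 < f c / 2 * (t - s) by rewrite mulr_gt0 ?divr_gt0 ?subr_gt0.
by rewrite ltr_wpDl// ltr_pwDl// (lt_le_trans h4 h3).
Qed.

Lemma Rintegral_fold T (c : R) (f : R -> R) : 0 <= c <= T ->
  measurable_fun `[0, T]%classic f -> (forall t, 0 <= t <= T -> 0 <= f t) ->
  Rintegral mu `[0, T]%classic (f \o fold c) = Rintegral mu `[0, T]%classic f.
Proof.
move=> cT mf f0; rewrite /Rintegral; congr fine.
apply: (@ge0_integral_fold _ c T (EFin \o f)) => //.
by apply/measurable_EFinP.
Qed.

Section rearrangement.
Variables (T : R) (x y u v : R -> R) (c : R).
Hypothesis T0 : 0 < T.
Hypothesis xu : H1_deriv T x u.
Hypothesis yv : H1_deriv T y v.
Hypothesis cT : 0 <= c <= T.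
Hypothesis xyc : radius x y c = 0.

Let speed := radius u v.
Let L2speed : L2 T speed.
Proof.
by apply: L2_radius; [case/H1_derivP: xu|case/H1_derivP: yv].
Qed.

Let fspeed := speed \o fold c.
Let L2fspeed : L2 T fspeed.
Proof.
case: L2speed => ms _; apply/L2P; split; first exact: measurable_fun_fold.
have := @ge0_integral_fold _ c T (fun t => (speed t ^+ 2)%:E) cT.
rewrite /fspeed /= => ->.
- by case/L2P : L2speed.
- exact/measurable_EFinP/measurable_funX.
- by move=> t _; rewrite lee_fin sqr_ge0.
Qed.

(* Length of the path measured from the collision at time [c], the part
   before [c] being run backwards. *)
Definition rlength t := Rintegral mu `[0, t]%classic fspeed.

Lemma H1_rlength : H1_deriv T rlength fspeed.
Proof. exact: H1_deriv_primitive. Qed.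

Lemma rlength_ge0 t : 0 <= rlength t.
Proof. by apply: Rintegral_ge0 => z _; exact: radius_ge0. Qed.

(** The distance to the origin is at most the arc length from the collision. For [t <= c] this arc
    length is exactly the right-hand side; for [t > c] the right-hand side counts the length of the
    part before [c] in addition. *)
Lemma radius_le_rlength t : 0 <= t <= T -> radius x y t <= rlength (fold c t).
Proof.
move=> tT; have [c0 cT'] := andP cT; have [t0 tT'] := andP tT.
have /eqP := xyc; rewrite radius_eq0 => /andP[/eqP xc0 /eqP yc0].
have ifs := L2_integrable L2fspeed.
have h1 z : 0 <= z <= c -> rlength z = Rintegral mu `[c - z, c]%classic speed.
  move=> /andP[z0 zc]; rewrite /rlength.
  have h := @ge0_integral_reflection _ 0 z c (EFin \o speed); rewrite subr0 in h.
  rewrite /Rintegral -h.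
  - congr fine; apply: eq_integral => w; rewrite inE/= in_itv/= => /andP[w0 wz].
    by rewrite /fspeed /= /fold (le_trans wz zc).
  - case: L2speed => ms _; apply/measurable_EFinP; apply: measurable_funS ms => //.
    by apply: subset_itv; rewrite bnd_simp//; lra.
  - by move=> w _; rewrite /= lee_fin radius_ge0.
rewrite /fold; case: (leP t c) => tc.
  rewrite h1; last by apply/andP; split; lra.
  have -> : c - (c - t) = t by lra.
  apply: le_trans (chord_le_length xu yv (s := t) (t := c) _ _) => //; last exact/andP.
  by rewrite xc0 yc0 !sub0r !sqrrN.
rewrite /rlength (Rintegral_split (b := c)); last 2 first.
- exact: integrable_subitv ifs (lexx _) _.
- by rewrite c0 ltW.
have -> : Rintegral mu `[c, t]%classic fspeed = Rintegral mu `[c, t]%classic speed.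
  rewrite -(@Rintegral_itv_obnd_cbnd _ c (BRight t)); last first.
    by apply: integrableS ifs => //; apply: subset_itv; rewrite bnd_simp.
  rewrite -(@Rintegral_itv_obnd_cbnd _ c (BRight t)); last first.
    by apply: integrableS (L2_integrable L2speed) => //; apply: subset_itv; rewrite bnd_simp.
  apply: eq_Rintegral => w; rewrite inE/= in_itv/= => /andP[cw _].
  by rewrite /fspeed/= /fold leNgt cw.
apply: (@le_trans _ _ (Rintegral mu `[c, t]%classic speed)); last first.
  by rewrite lerDr; exact: rlength_ge0.
have ct : 0 <= c <= t by rewrite c0 ltW.
apply: le_trans (chord_le_length xu yv ct tT').
by rewrite xc0 yc0 !subr0.
Qed.

(** The competitor on the negative axis. The leading [0 +] matches the form in which [H1_derivD]
    returns a linear combination. *)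
Let x' t := 0 + (- 1) * rlength t.
Let u' t := 0 + (- 1) * fspeed t.

Let xu' : H1_deriv T x' u'.
Proof. exact: (H1_derivD (-1) (H1_deriv_cst T 0) H1_rlength). Qed.

Let radius_x' t : radius x' (cst 0) t = rlength t.
Proof.
rewrite /radius /x' /cst expr0n/= addr0 add0r mulN1r sqrrN sqrtr_sqr.
by rewrite ger0_norm ?rlength_ge0.
Qed.

(** Kinetic energies are equal and the [1/r] terms compare in favour of the competitor, so
    minimality leaves only the integrals of [x]. *)
Lemma collision_rearrangement : minimizer T x y ->
  Rintegral mu `[0, T]%classic x + Rintegral mu `[0, T]%classic rlength <= 0.
Proof.
move=> m.
have irl : mu.-integrable `[0, T]%classic (EFin \o rlength).
  exact: H1_deriv_integrable H1_rlength.
have O' : Omega T x' (cst 0).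
  split; first by exists u'.
  split; first by exists (cst 0); exact: H1_deriv_cst.
  split => //; split => //; split.
    by rewrite /x' /rlength set_itv1 Rintegral_set1 mulr0 addr0.
  by rewrite /x' add0r mulN1r oppr_le0 rlength_ge0.
have y0 : H1_deriv T (cst 0) (cst 0) by exact: H1_deriv_cst.
have mr' := measurable_inv_radius_itv T0 xu' y0.
have := minimizer_le (c := 0) T0 m xu yv O' xu' y0.
rewrite adde0 addr0.
have -> : Rintegral mu `[0, T]%classic x' = - Rintegral mu `[0, T]%classic rlength.
  rewrite -mulN1r -RintegralZl//.
  by apply: eq_Rintegral => t _; rewrite /x' add0r.
have -> : kinetic T u' (cst 0) = kinetic T u v.
  rewrite /kinetic -[RHS](@Rintegral_fold T c); first last.
  - by move=> t _; rewrite mulr_ge0 ?invr_ge0// addr_ge0 ?sqr_ge0.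
  - have [[mu_ _] _] := (H1_derivP _ _ _).1 xu.
    have [[mv _] _] := (H1_derivP _ _ _).1 yv.
    by apply: measurable_funM => //; apply: measurable_funD; apply: measurable_funX.
  - by [].
  apply: eq_Rintegral => t _ /=; congr (_ * _).
  by rewrite /u' /cst expr0n addr0 add0r mulN1r sqrrN /fspeed /= /speed sqr_radius.
move=> h; suff /h : (\int[mu]_(t in `[0%R, T]) inv_radius x' (cst 0%R) t <=
    \int[mu]_(t in `[0%R, T]) inv_radius x y t)%E by lra.
(* The competitor is read at time [fold c t], the instant to be compared with time [t] of the
   minimizer. *)
rewrite -(@ge0_integral_fold _ c T)//; last by move=> t _; exact: inv_radius_ge0.
apply: ge0_le_integral => //.
- by move=> t _; exact: inv_radius_ge0.
- exact: (measurable_fun_fold cT mr').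
- exact: (measurable_inv_radius_itv T0 xu yv).
- move=> t /=; rewrite in_itv/= => tT; apply: le_inv_radius.
  by rewrite radius_x'; exact: radius_le_rlength.
Qed.

Lemma Rintegral_radius_le_rlength :
  Rintegral mu `[0, T]%classic (radius x y) <= Rintegral mu `[0, T]%classic rlength.
Proof.
have mrl := H1_deriv_measurable T0 H1_rlength.
have irl := H1_deriv_integrable T0 H1_rlength.
rewrite -[leRHS](@Rintegral_fold T c)//; last by move=> t _; exact: rlength_ge0.
have irf : mu.-integrable `[0, T]%classic (EFin \o (rlength \o fold c)).
  apply/integrableP; split; first by apply/measurable_EFinP; exact: (measurable_fun_fold cT mrl).
  have := @ge0_integral_fold _ c T (fun t => `|(rlength t)%:E|%E) cT.
  move=> ->//; first by move/integrableP : irl => [].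
  by apply: measurableT_comp => //; exact/measurable_EFinP.
apply: le_Rintegral => //; last first.
  by move=> t /=; rewrite in_itv/=; exact: radius_le_rlength.
apply: continuous_compact_integrable; first exact: segment_compact.
by apply: radius_continuous; apply: H1_deriv_continuous; [|exact: xu| |exact: yv].
Qed.

(** [x + r] is continuous and nonnegative, and the two preceding lemmas bound its integral by 0. *)
Lemma collision_on_negative_axis : minimizer T x y ->
  forall t, 0 <= t <= T -> x t = - radius x y t.
Proof.
move=> m t tT; apply/eqP; rewrite -addr_eq0; apply/negPn/negP => xr0.
have cx := H1_deriv_continuous T0 xu.
have cr : {within `[0, T], continuous (radius x y)}.
  by apply: radius_continuous => //; exact: H1_deriv_continuous yv.
have xr s : 0 <= x s + radius x y s.
  suff : `|x s| <= radius x y s by have := ler_norm (- x s); rewrite normrN; lra.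
  by rewrite /radius -sqrtr_sqr ler_wsqrtr// lerDl sqr_ge0.
have h : 0 < Rintegral mu `[0, T]%classic (fun s => x s + radius x y s).
  apply: (@Rintegral_gt0 T _ t) => //; last by rewrite lt_neqAle eq_sym xr0 xr.
  by move=> s; apply: cvgD; [exact: cx|exact: cr].
rewrite RintegralD// in h; last 2 first.
- exact: H1_deriv_integrable xu.
- by apply: continuous_compact_integrable => //; exact: segment_compact.
move: h; rewrite ltNge => /negP; apply.
by apply: le_trans (collision_rearrangement m); rewrite lerD2l Rintegral_radius_le_rlength.
Qed.

End rearrangement.

End collision.

Section collision_orbit.
Context {R : realType}.
Local Notation mu := (@lebesgue_measure R).

(** The rearrangement is used twice. With the given [c] it yields [x = - r], which together with
    [0 <= x 0] forces a collision at time 0. With collision time 0 it yields [x = - rlength], whence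
    monotonicity. *)
Lemma collision_orbit (T : R) (x y u v : R -> R) (c : R) : 0 < T -> minimizer T x y ->
  H1_deriv T x u -> H1_deriv T y v -> 0 <= c <= T -> radius x y c = 0 ->
  [/\ x 0 = 0, forall t, 0 <= t <= T -> y t = 0,
      forall t, 0 < t <= T -> x t < 0 &
      forall s t, 0 <= s <= t -> t <= T -> x t <= x s].
Proof.
move=> T0 m xu yv cT rc0.
have xE := collision_on_negative_axis T0 xu yv cT rc0 m.
have [_ [_ [_ [_ [x0 _]]]]] := m.1.
have T00 : (0 : R) <= 0 <= T by rewrite lexx ltW.
have x00 : x 0 = 0.
  by apply/eqP; rewrite eq_le x0 andbT (xE _ T00) oppr_le0 radius_ge0.
have r00 : radius x y 0 = 0.
  by apply/eqP; rewrite -oppr_eq0 -xE// x00.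
have y0 t : 0 <= t <= T -> y t = 0.
  move=> tT; have := sqr_radius x y t.
  rewrite -[in LHS]sqrrN -(xE _ tT) -[LHS]addr0 => /addrI/esym/eqP.
  by rewrite sqrf_eq0 => /eqP.
pose rl := rlength u v 0.
have rl1 := H1_rlength xu yv T00.
have rlx t : 0 <= t <= T -> 0 <= x t + rl t.
  move=> tT; rewrite (xE _ tT) addrC subr_ge0.
  have := radius_le_rlength xu yv T00 r00 tT.
  rewrite /fold; case: (leP t 0) => // t0.
  have -> : t = 0 by apply/eqP; rewrite eq_le t0; case/andP : tT.
  by rewrite subr0.
have xrl t : 0 <= t <= T -> x t = - rl t.
  move=> tT; apply/eqP; rewrite -addr_eq0; apply/negPn/negP => xr0.
  have h : 0 < Rintegral mu `[0, T]%classic (fun s => x s + rl s).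
    apply: (@Rintegral_gt0 _ T _ t) => //; last by rewrite lt_neqAle eq_sym xr0 rlx.
    have cx := H1_deriv_continuous T0 xu; have cr := H1_deriv_continuous T0 rl1.
    by move=> s; apply: cvgD; [exact: cx|exact: cr].
  rewrite RintegralD// in h; last 2 first.
  - exact: H1_deriv_integrable xu.
  - exact: H1_deriv_integrable rl1.
  move: h; rewrite ltNge => /negP; apply.
  exact: (collision_rearrangement T0 xu yv T00 r00 m).
have xmono s t : 0 <= s <= t -> t <= T -> x t <= x s.
  move=> /[dup] st /andP[s0 st'] tT.
  rewrite !xrl ?s0 ?(le_trans st')// ?(le_trans s0)//.
  rewrite lerN2 /rl (H1_deriv_increment rl1 st tT) lerDl.
  by apply: Rintegral_ge0 => z _; exact: radius_ge0.
split => // t /andP[t0 tT].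
have xt0 : x t <= 0 by have := xmono 0 t; rewrite x00 lexx ltW//=; apply.
(* A return to 0 at time [t] would, by monotonicity, keep the path at the origin on all of [[0, t]],
   making the integral of [1/r] infinite. *)
rewrite lt_neqAle xt0 andbT; apply/negP => /eqP xt.
have := minimizer_inv_radius_lty T0 m xu yv.
suff -> : (\int[mu]_(t in `[0%R, T]) inv_radius x y t = +oo)%E by [].
apply/eqP; rewrite eq_le leey/=.
apply: (@le_trans _ _ (\int[mu]_(s in `[0%R, t]) inv_radius x y s)%E); last first.
  apply: ge0_subset_integral => //.
  - exact: (measurable_inv_radius_itv T0 xu yv).
  - by move=> s _; exact: inv_radius_ge0.
  - by apply: subset_itv; rewrite bnd_simp.
rewrite (eq_integral (cst +oo%E)); last first.
  move=> s; rewrite inE/= in_itv/= => /andP[s0 st].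
  rewrite /inv_radius y0 ?s0 ?(le_trans st)// eqxx andbT.
  suff -> : x s = 0 by rewrite eqxx.
  apply/eqP; rewrite eq_le; apply/andP; split.
    by have := xmono 0 s; rewrite x00 lexx s0 (le_trans st)//=; apply.
  by have := xmono s t; rewrite xt s0 st tT; apply.
rewrite integral_cst//= lebesgue_measure_itv/= lte_fin t0 -EFinD gt0_mulye//.
by rewrite lte_fin subr0.
Qed.

End collision_orbit.

(** * Euler-Lagrange equations *)

Section first_variation.
Context {R : realType}.
Local Notation mu := (@lebesgue_measure R).

(** Second-order upper bound for [1/r], to bound the action of a varied path from above. The
    constant is [2 / (m^2 (m / 2))]: the old radius is at least [m], the new one at least
    [m / 2]. *)
Lemma inv_norm_taylor (a b p q m : R) : 0 < m ->
  m <= Num.sqrt (a ^+ 2 + b ^+ 2) -> Num.sqrt (p ^+ 2 + q ^+ 2) <= m / 2 ->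
  0 < Num.sqrt ((a + p) ^+ 2 + (b + q) ^+ 2) /\
  (Num.sqrt ((a + p) ^+ 2 + (b + q) ^+ 2))^-1 <= (Num.sqrt (a ^+ 2 + b ^+ 2))^-1 -
    (a * p + b * q) / Num.sqrt (a ^+ 2 + b ^+ 2) ^+ 3 + 4 / m ^+ 3 * (p ^+ 2 + q ^+ 2).
Proof.
move=> m0.
have r2 : Num.sqrt (a ^+ 2 + b ^+ 2) ^+ 2 = a ^+ 2 + b ^+ 2.
  by rewrite sqr_sqrtr// addr_ge0 ?sqr_ge0.
have d2 : Num.sqrt (p ^+ 2 + q ^+ 2) ^+ 2 = p ^+ 2 + q ^+ 2.
  by rewrite sqr_sqrtr// addr_ge0 ?sqr_ge0.
have s2 : Num.sqrt ((a + p) ^+ 2 + (b + q) ^+ 2) ^+ 2 = (a + p) ^+ 2 + (b + q) ^+ 2.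
  by rewrite sqr_sqrtr// addr_ge0 ?sqr_ge0.
move: r2 d2 s2 (sqrtr_ge0 (a ^+ 2 + b ^+ 2)) (sqrtr_ge0 (p ^+ 2 + q ^+ 2))
  (sqrtr_ge0 ((a + p) ^+ 2 + (b + q) ^+ 2)).
set r := Num.sqrt (a ^+ 2 + _); set d := Num.sqrt (p ^+ 2 + _); set s := Num.sqrt _.
move=> r2 d2 s2 r0 d0 s0 mr dm.
have rgt0 : 0 < r by lra.
set D := a * p + b * q.
have D2 : D ^+ 2 <= (r * d) ^+ 2.
  by rewrite exprMn r2 d2 /D; have := sqr_ge0 (a * q - b * p); nra.
have Drd : `|D| <= r * d.
  by rewrite -ler_sqr ?nnegrE ?mulr_ge0 ?normr_ge0// real_normK ?num_real.
have sE : s ^+ 2 = r ^+ 2 + 2 * D + d ^+ 2 by rewrite s2 r2 d2 /D; ring.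
have [D1 D1'] : - (r * d) <= D /\ D <= r * d by apply/andP; rewrite -ler_norml.
have s_up : s <= r + d.
  rewrite -ler_sqr ?nnegrE ?addr_ge0// sE; nra.
have s_lo : r - d <= s.
  rewrite -ler_sqr ?nnegrE ?sE//; [nra|lra].
have sm : m / 2 <= s by lra.
have sgt0 : 0 < s by lra.
split => //.
have P2 : p ^+ 2 + q ^+ 2 = s ^+ 2 - r ^+ 2 - 2 * D by rewrite -d2 sE; ring.
(* Exact remainder. Its numerator is quadratic in the perturbation because both [|D| <= r * d] and
   [|s - r| <= d]. *)
have -> : s^-1 = r^-1 - D / r ^+ 3 +
    (D * (s - r) * (s + 2 * r) - d ^+ 2 * r ^+ 2) / (r ^+ 3 * s * (r + s)).
  have -> : d ^+ 2 = s ^+ 2 - r ^+ 2 - 2 * D by rewrite sE; ring.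
  by field; rewrite !gt_eqF//; lra.
rewrite lerD2l -d2.
have h1 : D * (s - r) <= r * d ^+ 2.
  apply: le_trans (ler_norm _) _; rewrite normrM expr2 mulrA.
  by apply: ler_pM => //; rewrite ler_norml; apply/andP; split; lra.
have h2 : D * (s - r) * (s + 2 * r) - d ^+ 2 * r ^+ 2 <= 2 * r * d ^+ 2 * (r + s).
  have : D * (s - r) * (s + 2 * r) <= r * d ^+ 2 * (s + 2 * r) by apply: ler_wpM2r => //; lra.
  have : 0 <= d ^+ 2 * r ^+ 2 by rewrite mulr_ge0 ?sqr_ge0.
  have : 0 <= r * d ^+ 2 * s by rewrite !mulr_ge0 ?sqr_ge0.
  lra.
have rs0 : 0 < r ^+ 3 * s * (r + s) by rewrite !mulr_gt0 ?exprn_gt0//; lra.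
apply: (@le_trans _ _ (2 * r * d ^+ 2 * (r + s) / (r ^+ 3 * s * (r + s)))).
  by rewrite ler_pM2r// invr_gt0.
have -> : 2 * r * d ^+ 2 * (r + s) / (r ^+ 3 * s * (r + s)) = 2 / (r ^+ 2 * s) * d ^+ 2.
  by field; rewrite !gt_eqF//; lra.
apply: ler_wpM2r; first exact: sqr_ge0.
have -> : 4 / m ^+ 3 = 2 / (m ^+ 2 * (m / 2)) by field; rewrite gt_eqF.
have h3 : m ^+ 2 * (m / 2) <= r ^+ 2 * s.
  apply: ler_pM => //; [exact: sqr_ge0|lra|].
  by rewrite ler_sqr ?nnegrE//; lra.
have h4 : 0 < m ^+ 2 * (m / 2) by rewrite mulr_gt0 ?exprn_gt0// divr_gt0.
by rewrite ler_pM2l// lef_pV2 ?posrE// (lt_le_trans h4 h3).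
Qed.

Lemma quadratic_ge0_linear_eq0 (J C e0 : R) : 0 < e0 ->
  (forall e, `|e| <= e0 -> 0 <= e * J + e ^+ 2 * C) -> J = 0.
Proof.
move=> e00 h; apply/eqP/negPn/negP => J0.
have J2 : 0 < `|J| by rewrite normr_gt0.
pose k := `|J| + `|C| + 1 + e0.
have k0 : 0 < k by rewrite /k; have := normr_ge0 C; lra.
(* Test [e = - J * th]. Since [k] dominates [|J|], [|C|] and [e0], the product
   [th * k = e0 / (k + 1)] is below both [e0] and 1: thus [e] is admissible and [1 - th * C] is
   positive. *)
pose th := e0 / (k * (k + 1)).
have th0 : 0 < th by rewrite /th divr_gt0// mulr_gt0//; lra.
have kk : th * k * (k + 1) = e0 by rewrite /th; field; rewrite !gt_eqF//; lra.
have JCk : `|J| <= k /\ `|C| <= k /\ e0 <= k.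
  by rewrite /k; have := normr_ge0 C; have := normr_ge0 J; split; [|split]; lra.
clearbody th k.
have := h (- J * th); rewrite normrM normrN (ger0_norm (ltW th0)).
have : `|J| * th <= e0.
  rewrite -kk; have : `|J| * th <= k * th by rewrite ler_wpM2r//; lra.
  have : 0 <= th * k * k by rewrite !mulr_ge0 ?(ltW th0) ?(ltW k0).
  lra.
move=> /[swap] /[apply].
have -> : - J * th * J + (- J * th) ^+ 2 * C = - (J ^+ 2 * th * (1 - th * C)) by ring.
rewrite oppr_ge0 leNgt => /negP; apply.
apply: mulr_gt0; first by rewrite mulr_gt0// exprn_even_gt0.
rewrite subr_gt0.
have : th * C <= th * k by rewrite ler_wpM2l ?(ltW th0)//; have := ler_norm C; lra.
suff : th * k < 1 by lra.
have := mulr_gt0 th0 k0; nra.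
Qed.

Lemma H1_deriv_L2 T (f a : R -> R) : 0 < T -> H1_deriv T f a -> L2 T f.
Proof.
move=> T0 fa; split; first exact: H1_deriv_measurable fa.
have cf := H1_deriv_continuous T0 fa.
apply: continuous_compact_integrable; first exact: segment_compact.
by move=> t; apply: (@continuous_comp _ _ _ _ (fun z : R => z ^+ 2)); [exact: cf|exact: exprn_continuous].
Qed.

Lemma H1_deriv_bounded T (f a : R -> R) : 0 < T -> H1_deriv T f a ->
  exists2 B : R, 0 < B & forall t, 0 <= t <= T -> `|f t| <= B.
Proof.
move=> T0 fa; have cf := H1_deriv_continuous T0 fa.
have [c1 _ h1] := EVT_max (ltW T0) cf.
have [c2 _ h2] := EVT_min (ltW T0) cf.
exists (`|f c1| + `|f c2| + 1); first by rewrite ltr_wpDl// addr_ge0.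
move=> t tT; have := h1 t; have := h2 t; rewrite in_itv/= => /(_ tT) l /(_ tT) l'.
have := ler_norm (f c1); have := ler_norm (- f c2); rewrite normrN.
have := normr_ge0 (f c1); have := normr_ge0 (f c2).
rewrite ler_norml; set A := `|f c1|; set B := `|f c2|.
move: l l'; clear; move=> *; apply/andP; split; lra.
Qed.

Lemma kineticD T (u v a b : R -> R) (k : R) : L2 T u -> L2 T v -> L2 T a -> L2 T b ->
  kinetic T (fun t => u t + k * a t) (fun t => v t + k * b t) =
  kinetic T u v + k * Rintegral mu `[0, T]%classic (fun t => u t * a t + v t * b t) +
  k ^+ 2 * kinetic T a b.
Proof.
move=> Lu Lv La Lb; rewrite /kinetic.
have i1 : mu.-integrable `[0, T]%classic (EFin \o (fun t => 2^-1 * (u t ^+ 2 + v t ^+ 2))).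
  by apply: integrable_scale => //; apply: integrable_add => //; [case: Lu|case: Lv].
have i2 : mu.-integrable `[0, T]%classic (EFin \o (fun t => u t * a t + v t * b t)).
  by apply: integrable_add => //; exact: L2_mul.
have i3 : mu.-integrable `[0, T]%classic (EFin \o (fun t => 2^-1 * (a t ^+ 2 + b t ^+ 2))).
  by apply: integrable_scale => //; apply: integrable_add => //; [case: La|case: Lb].
rewrite -!RintegralZl//.
rewrite -RintegralD//; last exact: integrable_scale.
rewrite -RintegralD//; last 2 first.
- by apply: integrable_add => //; exact: integrable_scale.
- exact: integrable_scale.
by apply: eq_Rintegral => t _; field.
Qed.

Section variation.
Variables (T : R) (x y u v : R -> R).
Hypothesis T0 : 0 < T.
Hypothesis mxy : minimizer T x y.
Hypothesis xu : H1_deriv T x u.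
Hypothesis yv : H1_deriv T y v.

(** At an endpoint [p] may be nonzero only where the constraint on [x] is strict, so small
    variations of both signs are admissible and the linear term vanishes. [G] is only prescribed on
    [[0, T]], which lets it be built from a force continuous on the whole line. *)
Lemma first_variation (p q a b G : R -> R) (m : R) :
  H1_deriv T p a -> H1_deriv T q b -> 0 < m ->
  (forall t, 0 <= t <= T -> (p t = 0 /\ q t = 0) \/ m <= radius x y t) ->
  q 0 = 0 -> q T = 0 -> p 0 = 0 \/ 0 < x 0 -> p T = 0 \/ x T < 0 ->
  mu.-integrable `[0, T]%classic (EFin \o G) ->
  (forall t, 0 <= t <= T ->
    G t = p t - (x t * p t + y t * q t) / radius x y t ^+ 3) ->
  Rintegral mu `[0, T]%classic (fun t => u t * a t + v t * b t) +
  Rintegral mu `[0, T]%classic G = 0.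
Proof.
move=> pa qb m0 farm q0 qT p0 pT iG GE.
have [Lu _] := (H1_derivP _ _ _).1 xu.
have [Lv _] := (H1_derivP _ _ _).1 yv.
have [La _] := (H1_derivP _ _ _).1 pa.
have [Lb _] := (H1_derivP _ _ _).1 qb.
have Lp := H1_deriv_L2 T0 pa; have Lq := H1_deriv_L2 T0 qb.
have [B1 B10 pB] := H1_deriv_bounded T0 pa.
have [B2 B20 qB] := H1_deriv_bounded T0 qb.
have T00 : (0 : R) <= 0 <= T by rewrite lexx ltW.
have TT0 : 0 <= T <= T by rewrite lexx ltW.
have [_ [_ [y0 [yT [x0 xT]]]]] := mxy.1.
have [e1 e10 e1P] : exists2 e1, 0 < e1 & forall e, `|e| <= e1 -> 0 <= x 0 + e * p 0.
  case: p0 => [->|x0p]; first by exists 1 => // e _; rewrite mulr0 addr0.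
  exists (x 0 / B1); first exact: divr_gt0.
  move=> e; rewrite ler_pdivlMr// => eB; rewrite -lerBlDl sub0r.
  have : `|e * p 0| <= x 0 by rewrite normrM (le_trans _ eB)// ler_wpM2l// pB.
  by rewrite ler_norml => /andP[? ?]; lra.
have [e2 e20 e2P] : exists2 e2, 0 < e2 & forall e, `|e| <= e2 -> x T + e * p T <= 0.
  case: pT => [->|xTp]; first by exists 1 => // e _; rewrite mulr0 addr0.
  exists (- x T / B1); first by rewrite divr_gt0// oppr_gt0.
  move=> e; rewrite ler_pdivlMr// => eB.
  have : `|e * p T| <= - x T by rewrite normrM (le_trans _ eB)// ler_wpM2l// pB.
  by rewrite ler_norml => /andP[? ?]; lra.
(* Keeps the displacement [e * (p, q)] within the radius [m / 2] required by [inv_norm_taylor]. *)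
pose e3 := m / 2 / (B1 + B2).
have e30 : 0 < e3 by rewrite /e3 !divr_gt0// addr_gt0.
pose C1 := 4 / m ^+ 3.
have ip : mu.-integrable `[0, T]%classic (EFin \o p) by exact: L2_integrable.
have ipq : mu.-integrable `[0, T]%classic (EFin \o (fun t => p t ^+ 2 + q t ^+ 2)).
  by apply: integrable_add => //; [case: Lp|case: Lq].
have iNp : mu.-integrable `[0, T]%classic (EFin \o (fun t => -1 * p t)).
  exact: integrable_scale.
have iGp : mu.-integrable `[0, T]%classic (EFin \o (fun t => G t + -1 * p t)).
  exact: integrable_add.
apply: (@quadratic_ge0_linear_eq0 _ (kinetic T a b +
  C1 * Rintegral mu `[0, T]%classic (fun t => p t ^+ 2 + q t ^+ 2)) (Num.min e1 (Num.min e2 e3))).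
  by rewrite !lt_min e10 e20 e30.
move=> e; rewrite !le_min => /and3P[ee1 ee2 ee3].
have xu' := H1_derivD e xu pa; have yv' := H1_derivD e yv qb.
have O' : Omega T (fun t => x t + e * p t) (fun t => y t + e * q t).
  split; first by exists (fun t => u t + e * a t).
  split; first by exists (fun t => v t + e * b t).
  by rewrite y0 yT q0 qT mulr0 addr0; do 2 split => //; split; [exact: e1P|exact: e2P].
(* Bound for the change of [1/r] alone: [p] is subtracted from [G] because the linear term of the
   action in [x] is counted separately. *)
pose d t := e * (G t + -1 * p t) + e ^+ 2 * C1 * (p t ^+ 2 + q t ^+ 2).
have id_ : mu.-integrable `[0, T]%classic (EFin \o d).
  by apply: integrable_add => //; exact: integrable_scale.
have Ed : Rintegral mu `[0, T]%classic d =
    e * (Rintegral mu `[0, T]%classic G + -1 * Rintegral mu `[0, T]%classic p) +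
    e ^+ 2 * C1 * Rintegral mu `[0, T]%classic (fun t => p t ^+ 2 + q t ^+ 2).
  rewrite -RintegralZl// -RintegralD// -RintegralZl// -RintegralZl// -RintegralD//.
  - exact: integrable_scale.
  - exact: integrable_scale.
have Ex : Rintegral mu `[0, T]%classic (fun t => x t + e * p t) =
    Rintegral mu `[0, T]%classic x + e * Rintegral mu `[0, T]%classic p.
  rewrite -RintegralZl// -RintegralD//; first exact: H1_deriv_integrable xu.
  exact: integrable_scale.
have := minimizer_le_pointwise T0 mxy xu yv O' xu' yv' id_ _.
rewrite kineticD// Ed Ex.
set K1 := kinetic T u v; set X := Rintegral mu _ x; set I1 := Rintegral mu _ (fun t => _ * a t + _).
set IG := Rintegral mu _ G; set Ip := Rintegral mu _ p.
set I2 := Rintegral mu _ (fun t => p t ^+ 2 + _); set K2 := kinetic T a b.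
have arith : K1 + X <= K1 + e * I1 + e ^+ 2 * K2 + (X + e * Ip) +
    (e * (IG + -1 * Ip) + e ^+ 2 * C1 * I2) -> 0 <= e * (I1 + IG) + e ^+ 2 * (K2 + C1 * I2).
  clear; lra.
move=> h; apply/arith/h => t tT.
case: (farm _ tT) => [[pt qt]|mt].
  have -> : inv_radius (fun s => x s + e * p s) (fun s => y s + e * q s) t = inv_radius x y t.
    by rewrite /inv_radius /radius pt qt mulr0 !addr0.
  have -> : d t = 0 by rewrite /d GE// pt qt; ring.
  by rewrite adde0.
have small : Num.sqrt ((e * p t) ^+ 2 + (e * q t) ^+ 2) <= m / 2.
  have -> : (e * p t) ^+ 2 + (e * q t) ^+ 2 = e ^+ 2 * (p t ^+ 2 + q t ^+ 2) by ring.
  rewrite sqrtrM ?sqr_ge0// sqrtr_sqr.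
  have : Num.sqrt (p t ^+ 2 + q t ^+ 2) <= B1 + B2.
    apply: (@le_trans _ _ (`|p t| + `|q t|)); last by apply: lerD; [exact: pB|exact: qB].
    rewrite -(ger0_norm (addr_ge0 (normr_ge0 (p t)) (normr_ge0 (q t)))) -sqrtr_sqr ler_wsqrtr//.
    rewrite sqrrD !real_normK ?num_real// addrAC lerDl.
    by rewrite mulrn_wge0// mulr_ge0.
  move=> h1; apply: (@le_trans _ _ (e3 * (B1 + B2))).
    by apply: ler_pM => //; exact: sqrtr_ge0.
  by rewrite /e3 divfK// gt_eqF// addr_gt0.
have [s0 hs] := inv_norm_taylor m0 mt small.
rewrite /inv_radius -(radius_eq0 (fun s => x s + e * p s) (fun s => y s + e * q s)).
rewrite -(radius_eq0 x y) (gt_eqF (lt_le_trans m0 mt)) /radius (gt_eqF s0).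
rewrite -EFinD lee_fin; apply: le_trans hs _.
rewrite /d GE// /C1 /radius le_eqVlt; apply/orP; left; apply/eqP.
set r3 := (Num.sqrt _ ^+ 3)^-1; set r1 := (Num.sqrt _)^-1.
ring.
Qed.

End variation.

End first_variation.

Section euler_lagrange.
Context {R : realType}.
Local Notation mu := (@lebesgue_measure R).

(** Starting the primitives at -2 puts time 0 in the interior, so the derivatives there are
    two-sided. [Q] is frozen below -1 to be continuous on the whole line, which allows a second
    primitive. *)
Lemma double_primitive (F : R -> R) : continuous F ->
  exists Q S : R -> R, continuous Q /\ forall t : R, -1 < t ->
    is_derive t 1 Q (F t) /\ is_derive t 1 S (Q t).
Proof.
have prim (f : R -> R) : continuous f -> exists g : R -> R, forall t : R, -2 < t ->
    is_derive t 1 g (f t).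
  move=> cf; exists (fun t => Rintegral mu `[-2, t]%classic f) => t t2.
  have If : mu.-integrable `[-2, t + 1]%classic (EFin \o f).
    apply: continuous_compact_integrable; first exact: segment_compact.
    exact/continuous_subspaceT.
  have tt1 : t < t + 1 by rewrite ltrDl.
  have [d dE] := continuous_FTC1_closed tt1 If t2 (cf t).
  by rewrite -dE derive1E; exact: derivableP.
move=> cF; have [Q0 dQ0] := prim _ cF.
pose Q t := Q0 (Num.max (-1) t).
have cQ : continuous Q.
  move=> t; apply: (@continuous_comp _ _ _ (fun t : R => Num.max (-1) t) Q0).
    by apply: continuous_max; [exact: cst_continuous|exact: cvg_id].
  have [d _] : is_derive (Num.max (-1) t) 1 Q0 (F (Num.max (-1) t)).
    by apply: dQ0; rewrite lt_max; apply/orP; left; lra.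
  exact/differentiable_continuous/derivable1_diffP.
have [S dS] := prim _ cQ.
exists Q, S; split => // t t1; split; last by apply: dS; lra.
have := dQ0 t; move=> /(_ ltac:(lra)); apply: near_eq_is_derive.
near=> s; rewrite /Q; congr Q0; apply/esym/max_idPr/ltW.
by near: s; exact: lt_nbhsr.
Unshelve. all: by end_near. Qed.

(* The variation along [hat d t], whose derivative is the indicator of [d, t],
   computes [x t - x d] directly; this replaces the du Bois-Reymond lemma. *)
Definition hat (d t s : R) : R := Num.max 0 (Num.min s t - d).

Lemma H1_hat (T d t : R) : 0 <= d <= t -> t <= T ->
  H1_deriv T (hat d t) (\1_(`[d, t]%classic)).
Proof.
move=> /andP[d0 dt] tT; apply/H1_derivP; split.
  apply: L2_sub (L2_cst T 1) _; first exact: measurable_indic.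
  by move=> s _; rewrite indicE /cst; case: (_ \in _); rewrite ?normr0 ?normr1.
move=> s /andP[s0 sT].
have -> : hat d t 0 = 0.
  by rewrite /hat; apply/max_idPl; rewrite subr_le0 ge_min d0.
rewrite add0r /Rintegral integral_indic//.
have [sd|ds] := ltP s d.
  have -> : hat d t s = 0.
    by rewrite /hat; apply/max_idPl; rewrite subr_le0 ge_min ltW.
  rewrite (_ : _ `&` _ = set0) ?measure0//.
  apply/seteqP; split => z //= -[]; rewrite !in_itv/= => /andP[h1 _] /andP[_ h2].
  by move: (le_lt_trans (le_trans h1 h2) sd); rewrite ltxx.
have -> : hat d t s = Num.min s t - d.
  by rewrite /hat; apply/max_idPr; rewrite subr_ge0 le_min ds.
rewrite (_ : _ `&` _ = `[d, Num.min s t]%classic); last first.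
  apply/seteqP; split => z /=; rewrite !in_itv/= le_min.
    by move=> [/andP[-> ->] /andP[_ ->]].
  by move=> /and3P[dz -> ->]; rewrite dz (le_trans d0 dz).
rewrite /= lebesgue_measure_itv/= lte_fin; case: ltP => //= h.
by apply/eqP; rewrite subr_eq0 eq_le h le_min ds dt.
Qed.

Lemma Rintegral_mul_indic (T d t : R) (u : R -> R) : 0 <= d -> t <= T ->
  Rintegral mu `[0, T]%classic (fun s => u s * \1_(`[d, t]%classic) s) =
  Rintegral mu `[d, t]%classic u.
Proof.
move=> d0 tT.
have -> : `[d, t]%classic = `[0, T]%classic `&` `[d, t]%classic.
  apply/seteqP; split => z /=; rewrite !in_itv/=; last by case.
  by move=> /andP[h1 h2]; rewrite h1 h2 (le_trans d0 h1) (le_trans h2 tT).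
rewrite Rintegral_mkcondr; apply: eq_Rintegral => z /[!inE] zT.
rewrite indicE patchE in_setI (mem_set zT)/=.
by case: ifP => _; rewrite ?mulr1 ?mulr0.
Qed.

(** The integrand vanishes on [[0, d]], has primitive [Q s * (s - d) - S s] on [[d, t]], and
    [Q s * (t - d)] on [[t, T]]. *)
Lemma Rintegral_hat (T d t : R) (F Q S : R -> R) : 0 <= d <= t -> t <= T ->
  continuous F -> continuous Q ->
  (forall s : R, -1 < s -> is_derive s 1 Q (F s) /\ is_derive s 1 S (Q s)) ->
  Rintegral mu `[0, T]%classic (fun s => F s * hat d t s) = (t - d) * Q T - S t + S d.
Proof.
move=> /andP[d0 dt] tT cF cQ dQS.
have chat : continuous (hat d t).
  move=> s; apply: (@continuous_max _ _ (fun=> 0) (fun s => Num.min s t - d)); first exact: cst_continuous.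
  apply: cvgB; last exact: cvg_cst.
  by apply: continuous_min; [exact: cvg_id|exact: cst_continuous].
have int a b : mu.-integrable `[a, b]%classic (EFin \o (fun s => F s * hat d t s)).
  apply: continuous_compact_integrable; first exact: segment_compact.
  by apply/continuous_subspaceT => s; apply: cvgM; [exact: cF|exact: chat].
rewrite (@Rintegral_split _ _ 0 d T)//; last by rewrite d0 (le_trans dt).
rewrite (@Rintegral_split _ _ d t T)//; last by rewrite dt.
have -> : Rintegral mu `[0, d]%classic (fun s => F s * hat d t s) = 0.
  rewrite (@eq_Rintegral _ _ _ _ _ (cst 0)) ?Rintegral_cst//= ?mul0r// => s.
  rewrite inE/= in_itv/= => /andP[_ sd].
  by rewrite /hat (max_idPl _) ?mulr0// subr_le0 ge_min sd.
have -> : Rintegral mu `[d, t]%classic (fun s => F s * hat d t s) =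
    Q t * (t - d) - S t - (Q d * (d - d) - S d).
  transitivity (Rintegral mu `[d, t]%classic (fun s => F s * (s - d))).
    apply: eq_Rintegral => s; rewrite inE/= in_itv/= => /andP[ds st].
    by rewrite /hat (min_idPl st) (max_idPr _)// subr_ge0.
  have dP s : d <= s <= t -> is_derive s 1 (fun s => Q s * (s - d) - S s) (F s * (s - d)).
    move=> /andP[ds _]; have [dQ dS] := dQS s ltac:(lra).
    by apply: is_derive_eq; rewrite /GRing.scale/=; ring.
  apply: (FTC_Rintegral dt dP) => s.
  by apply: cvgM; [exact: cF|apply: cvgB; [exact: cvg_id|exact: cvg_cst]].
have -> : Rintegral mu `[t, T]%classic (fun s => F s * hat d t s) =
    Q T * (t - d) - Q t * (t - d).
  transitivity (Rintegral mu `[t, T]%classic (fun s => F s * (t - d))).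
    apply: eq_Rintegral => s; rewrite inE/= in_itv/= => /andP[ts _].
    by rewrite /hat (min_idPr ts) (max_idPr _)// subr_ge0.
  have dP s : t <= s <= T -> is_derive s 1 (fun s => Q s * (t - d)) (F s * (t - d)).
    move=> /andP[ts _]; have [dQ dS] := dQS s ltac:(lra).
    by apply: is_derive_eq; rewrite /GRing.scale/=; ring.
  apply: (FTC_Rintegral tT dP) => s.
  by apply: cvgM; [exact: cF|exact: cvg_cst].
ring.
Qed.

End euler_lagrange.

(** * Equations of a minimizer on an interval without collision *)

Section minimizer_equation.
Context {R : realType}.
Local Notation mu := (@lebesgue_measure R).

Definition clamp (a b t : R) : R := Num.max a (Num.min t b).

Lemma clamp_id (a b t : R) : a <= t <= b -> clamp a b t = t.
Proof. by move=> /andP[at_ tb]; rewrite /clamp (min_idPl tb) (max_idPr at_). Qed.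

Lemma clamp_itv (a b t : R) : a <= b -> a <= clamp a b t <= b.
Proof. by move=> ab; rewrite /clamp le_max lexx/= ge_max ab ge_min lexx orbT. Qed.

Variables (T : R) (x y u v : R -> R).
Hypothesis T0 : 0 < T.
Hypothesis mxy : minimizer T x y.
Hypothesis xu : H1_deriv T x u.
Hypothesis yv : H1_deriv T y v.

(** A collision-free minimizer is treated with [d = 0]; after a collision at time 0, [d] is a
    positive time chosen as small as needed. *)
Variables (d m : R).
Hypothesis d0 : 0 <= d.
Hypothesis dT : d < T.
Hypothesis m0 : 0 < m.
Hypothesis far : forall t, d <= t <= T -> m <= radius x y t.

(* Frozen outside [d, T], so that it is continuous on the whole line. *)
Definition force_x (t : R) := let s := clamp d T t in 1 - x s / radius x y s ^+ 3.
Definition force_y (t : R) := let s := clamp d T t in - y s / radius x y s ^+ 3.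

Let sub_itv : `[d, T]%classic `<=` `[0, T]%classic.
Proof. by apply: subset_itv; rewrite bnd_simp. Qed.

Let cx : {within `[d, T], continuous x}.
Proof. exact: continuous_subspaceW sub_itv (H1_deriv_continuous T0 xu). Qed.

Let cy : {within `[d, T], continuous y}.
Proof. exact: continuous_subspaceW sub_itv (H1_deriv_continuous T0 yv). Qed.

Let rne0 t : radius x y (clamp d T t) != 0.
Proof.
by rewrite gt_eqF// (lt_le_trans m0)// far// clamp_itv// ltW.
Qed.

Let cx' : continuous (fun t => x (clamp d T t)).
Proof. exact: continuous_clamp (ltW dT) cx. Qed.

Let cy' : continuous (fun t => y (clamp d T t)).
Proof. exact: continuous_clamp (ltW dT) cy. Qed.

Let cr' : continuous (fun t => (radius x y (clamp d T t) ^+ 3)^-1).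
Proof.
move=> t; apply: cvgV; first exact/expf_neq0/rne0.
apply: (@continuous_comp _ _ _ (fun t => radius x y (clamp d T t)) (fun z : R => z ^+ 3)); last exact: exprn_continuous.
exact: (continuous_clamp (ltW dT) (radius_continuous cx cy)).
Qed.

Lemma continuous_force_x : continuous force_x.
Proof.
move=> t; apply: cvgB; first exact: cvg_cst.
by apply: cvgM; [exact: cx'|exact: cr'].
Qed.

Lemma continuous_force_y : continuous force_y.
Proof.
move=> t; apply: cvgM; last exact: cr'.
by apply: cvgN; exact: cy'.
Qed.

Let hat0 t s : s <= d -> hat d t s = 0.
Proof. by move=> sd; rewrite /hat (max_idPl _)// subr_le0 ge_min sd. Qed.

Let integrable_hat (F : R -> R) t : continuous F -> d <= t <= T ->
  mu.-integrable `[0, T]%classic (EFin \o (fun s => F s * hat d t s)).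
Proof.
move=> cF /andP[dt tT].
have chat := H1_deriv_continuous T0 (H1_hat (introT andP (conj d0 dt)) tT).
apply: continuous_compact_integrable; first exact: segment_compact.
by move=> s; apply: cvgM; [exact: (continuous_subspaceT cF)|exact: chat].
Qed.

(** [hat d t] does not vanish at [T] when [t > d], which is admissible since [x T < 0]. The first
    variation then gives [x t] explicitly; the constant [Q T] it contains is what makes [P T = 0],
    the natural boundary condition. *)
Lemma minimizer_equation_x : x T < 0 ->
  exists X P : R -> R, [/\ forall t : R, -1 < t ->
      is_derive t 1 X (P t) /\ is_derive t 1 P (force_x t),
    P T = 0 & forall t, d <= t <= T -> x t = X t].
Proof.
move=> xT0; have [Q [S [cQ dQS]]] := double_primitive continuous_force_x.
exists (fun t => x d + (S t - S d - (t - d) * Q T)), (fun t => Q t - Q T); split.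
- move=> t /dQS[dQ dS]; split.
    by apply: is_derive_eq; rewrite /GRing.scale/=; ring.
  by apply: is_derive_eq; rewrite /GRing.scale/=; ring.
- by rewrite subrr.
move=> t dtT; have [dt tT] := andP dtT.
have ddt : 0 <= d <= t by rewrite d0.
have := first_variation T0 mxy xu yv (H1_hat ddt tT) (H1_deriv_cst T 0) m0 _ erefl erefl
  (or_introl (hat0 t d0)) (or_intror xT0) (integrable_hat continuous_force_x dtT).
rewrite (Rintegral_hat ddt tT continuous_force_x cQ dQS).
have -> : Rintegral mu `[0, T]%classic (fun s => u s * \1_(`[d, t]%classic) s + v s * cst 0 s) =
    x t - x d.
  rewrite (H1_deriv_increment xu ddt tT) [x d + _]addrC addrK -(Rintegral_mul_indic u d0 tT).
  by apply: eq_Rintegral => s _; rewrite /cst mulr0 addr0.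
move=> h; suff : x t - x d + ((t - d) * Q T - S t + S d) = 0.
  by move=> /eqP; rewrite addr_eq0 subr_eq => /eqP ->; ring.
apply: h => s /andP[s0 sT].
  have [sd|ds] := leP s d; first by left; rewrite hat0.
  by right; apply: far; rewrite (ltW ds).
have [sd|ds] := leP s d; first by rewrite hat0//; rewrite /cst; ring.
rewrite /force_x clamp_id ?(ltW ds)// /cst; ring.
Qed.

(** Translation along the [x]-axis is an admissible variation: both end constraints are strict. With
    [P T = 0] this gives zero velocity in [x] at time 0. *)
Lemma minimizer_equation_x0 : d = 0 -> 0 < x 0 -> x T < 0 ->
  Rintegral mu `[0, T]%classic force_x = 0.
Proof.
move=> dE x0 xT.
have iF : mu.-integrable `[0, T]%classic (EFin \o force_x).
  apply: continuous_compact_integrable; first exact: segment_compact.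
  exact/continuous_subspaceT/continuous_force_x.
have := first_variation T0 mxy xu yv (H1_deriv_cst T 1) (H1_deriv_cst T 0) m0 _ erefl erefl
  (or_intror x0) (or_intror xT) iF.
rewrite (@eq_Rintegral _ _ _ _ _ (cst 0)) ?Rintegral_cst//= ?mul0r ?add0r; last first.
  by move=> s _; rewrite /cst !mulr0 addr0.
apply => s sT; first by right; apply: far; rewrite dE.
rewrite /force_x clamp_id ?dE// /cst; ring.
Qed.

(** Here variations must vanish at both ends. The one used, [q s = min s t - s * t / T] on [[0, T]],
    is the Green function of [- d^2/ds^2] with Dirichlet conditions; the slope [(S 0 - S T) / T] is
    what makes [Y T = 0]. *)
Lemma minimizer_equation_y : d = 0 ->
  exists Y P : R -> R, (forall t : R, -1 < t ->
      is_derive t 1 Y (P t) /\ is_derive t 1 P (force_y t)) /\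
    forall t, 0 <= t <= T -> y t = Y t.
Proof.
move=> dE; have [Q [S [cQ dQS]]] := double_primitive continuous_force_y.
have Tn0 : T != 0 by rewrite gt_eqF.
exists (fun t => S t - S 0 + t * ((S 0 - S T) / T)), (fun t => Q t + (S 0 - S T) / T); split.
- move=> t /dQS[dQ dS]; split.
    by apply: is_derive_eq; rewrite /GRing.scale/=; ring.
  by apply: is_derive_eq; rewrite /GRing.scale/=; ring.
move=> t tT'; have [t0 tT] := andP tT'.
have [_ [_ [y0 [yT _]]]] := mxy.1.
have ddt : 0 <= d <= t by rewrite dE lexx.
have ddT : 0 <= d <= T by rewrite dE lexx ltW.
pose k := - (t / T).
pose q s := hat d t s + k * hat d T s.
pose b s := \1_(`[d, t]%classic) s + k * \1_(`[d, T]%classic) s.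
have qb : H1_deriv T q b.
  exact: H1_derivD (H1_hat ddt tT) (H1_hat ddT (lexx T)).
have i1 := integrable_hat continuous_force_y (t := t).
have i2 := integrable_hat continuous_force_y (t := T).
rewrite dE in i1 i2; move: (i1 tT') (i2 ltac:(by rewrite lexx ltW)) => {}i1 {}i2.
have iG : mu.-integrable `[0, T]%classic (EFin \o (fun s =>
    force_y s * hat 0 t s + k * (force_y s * hat 0 T s))).
  by apply: integrable_add => //; exact: integrable_scale.
have q0 : q 0 = 0 by rewrite /q !hat0// mulr0 addr0.
have qT : q T = 0.
  rewrite /q /hat dE !subr0 (min_idPr tT) (max_idPr t0) minxx (max_idPr (ltW T0)) /k mulNr.
  by rewrite divfK// subrr.
have := first_variation T0 mxy xu yv (H1_deriv_cst T 0) qb m0 _ q0 qT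
  (or_introl erefl) (or_introl erefl) iG.
have ddt' : (0 : R) <= 0 <= t by rewrite lexx.
have ddT' : (0 : R) <= 0 <= T by rewrite lexx ltW.
have -> : Rintegral mu `[0, T]%classic (fun s =>
    force_y s * hat 0 t s + k * (force_y s * hat 0 T s)) =
    ((t - 0) * Q T - S t + S 0) + k * ((T - 0) * Q T - S T + S 0).
  rewrite -(Rintegral_hat ddt' tT continuous_force_y cQ dQS).
  rewrite -(Rintegral_hat ddT' (lexx T) continuous_force_y cQ dQS).
  by rewrite -RintegralZl// -RintegralD//; exact: integrable_scale.
have -> : Rintegral mu `[0, T]%classic (fun s => u s * cst 0 s + v s * b s) = y t.
  have Lv := ((H1_derivP _ _ _).1 yv).1.
  have j1 (z : R) : 0 <= d <= z -> z <= T ->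
      mu.-integrable `[0, T]%classic (EFin \o (fun s => v s * \1_(`[d, z]%classic) s)).
    by move=> dz zT; apply: L2_mul Lv ((H1_derivP _ _ _).1 (H1_hat dz zT)).1.
  transitivity (Rintegral mu `[0, T]%classic (fun s =>
     v s * \1_(`[d, t]%classic) s + k * (v s * \1_(`[d, T]%classic) s))).
    by apply: eq_Rintegral => s _; rewrite /cst /b; ring.
  rewrite RintegralD//; [|exact: j1|by apply: integrable_scale => //; exact: j1].
  rewrite RintegralZl//; last exact: j1.
  rewrite !Rintegral_mul_indic// dE.
  have := H1_deriv_increment yv ddT' (lexx T); rewrite y0 yT add0r => <-.
  by have := H1_deriv_increment yv ddt' tT; rewrite y0 add0r mulr0 addr0 => <-.
move=> h; have {}h : y t + (((t - 0) * Q T - S t + S 0) + k * ((T - 0) * Q T - S T + S 0)) = 0.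
  apply: h => s sT; first by right; apply: far; rewrite dE.
  by rewrite /force_y clamp_id ?dE// /cst /q dE; ring.
have -> : y t = - (((t - 0) * Q T - S t + S 0) + k * ((T - 0) * Q T - S T + S 0)).
  by apply/eqP; rewrite -addr_eq0 h.
by rewrite /k; field.
Qed.

End minimizer_equation.

(** * Collision-free minimizers *)

Section parabolic_coordinates.
Context {R : realType}.

Lemma is_derive_within_continuous (f df : R -> R) (a b : R) :
  (forall t : R, a <= t <= b -> is_derive t 1 f (df t)) -> {within `[a, b], continuous f}.
Proof.
move=> h; apply: derivable_within_continuous => t; rewrite in_itv/= => /h.
by case.
Qed.

Lemma is_derive_sqrt_comp (g : R -> R) (t dg : R) : 0 < g t -> is_derive t 1 g dg ->
  is_derive t 1 (fun s => Num.sqrt (g s)) (dg / (2 * Num.sqrt (g t))).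
Proof.
move=> gt0 hg; have h := is_derive1_sqrt gt0.
by rewrite mulrC; exact: (@is_derive1_comp _ (@Num.sqrt R) g _ _ _ h hg).
Qed.

Variables (T : R) (X Y P Q : R -> R).
Hypothesis T0 : 0 < T.
Local Notation r := (radius X Y).
Hypothesis r0 : forall t, 0 <= t <= T -> r t != 0.
Hypothesis dX : forall t : R, 0 <= t <= T -> is_derive t 1 X (P t).
Hypothesis dP : forall t : R, 0 <= t <= T -> is_derive t 1 P (1 - X t / r t ^+ 3).
Hypothesis dY : forall t : R, 0 <= t <= T -> is_derive t 1 Y (Q t).
Hypothesis dQ : forall t : R, 0 <= t <= T -> is_derive t 1 Q (- Y t / r t ^+ 3).
Hypotheses (Y0 : Y 0 = 0) (YT : Y T = 0) (X0 : 0 < X 0) (XT : X T < 0).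
Hypotheses (P0 : P 0 = 0) (PT : P T = 0).
Hypothesis Ygt0 : forall t, 0 < t < T -> 0 < Y t.

Let rgt0 t : 0 <= t <= T -> 0 < r t.
Proof. by move=> /r0; rewrite lt_neqAle eq_sym radius_ge0 andbT. Qed.

Let le_ooW (t : R) : 0 < t < T -> 0 <= t <= T.
Proof. by move=> /andP[? ?]; rewrite !ltW. Qed.

Let dr t : 0 <= t <= T -> is_derive t 1 r ((X t * P t + Y t * Q t) / r t).
Proof.
move=> tT; have dXt := dX tT; have dYt := dY tT.
have s0 : 0 < X t ^+ 2 + Y t ^+ 2 by rewrite -sqr_radius exprn_gt0// rgt0.
have hg : is_derive t 1 (fun t => X t ^+ 2 + Y t ^+ 2) (2 * (X t * P t + Y t * Q t)).
  by apply: is_derive_eq; rewrite /GRing.scale/=; ring.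
have h := @is_derive_sqrt_comp (fun t => X t ^+ 2 + Y t ^+ 2) _ _ s0 hg.
by apply: is_derive_eq h _; rewrite -/(radius X Y t); field; exact: r0.
Qed.

Let energy t := 2^-1 * (P t ^+ 2 + Q t ^+ 2) - (r t)^-1 - X t.

Let energy_cst t : 0 <= t <= T -> energy t = energy 0.
Proof.
move=> /andP[]; rewrite le_eqVlt => /predU1P[<-//|t0] tT.
have dE s : 0 <= s <= t -> is_derive s 1 energy 0.
  move=> /andP[s0 st]; have sT : 0 <= s <= T by rewrite s0 (le_trans st).
  have dXs := dX sT; have dYs := dY sT; have dPs := dP sT; have dQs := dQ sT.
  have drs := dr sT; have rs0 := r0 sT.
  have dVs := is_deriveV rs0 drs.
  apply: is_derive_eq; rewrite /GRing.scale/=.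
  by field.
have [s] := MVT t0 (fun s (h : s \in `]0, t[) => dE s ltac:(by move: h; rewrite in_itv/= => /andP[? ?]; rewrite !ltW)) (is_derive_within_continuous dE).
by move=> _ /eqP; rewrite mul0r subr_eq0 => /eqP.
Qed.

(* [(U + i V) ^+ 2 = X + i Y] *)
Let U t := Num.sqrt ((r t + X t) / 2).
Let V t := Num.sqrt ((r t - X t) / 2).

Let normX_le_r t : `|X t| <= r t.
Proof. by rewrite /radius -sqrtr_sqr ler_wsqrtr// lerDl sqr_ge0. Qed.

Let UU t : U t ^+ 2 = (r t + X t) / 2.
Proof.
have := normX_le_r t; rewrite ler_norml => /andP[h1 h2].
by rewrite /U sqr_sqrtr// divr_ge0//; lra.
Qed.

Let VV t : V t ^+ 2 = (r t - X t) / 2.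
Proof.
have := normX_le_r t; rewrite ler_norml => /andP[h1 h2].
by rewrite /V sqr_sqrtr// divr_ge0//; lra.
Qed.

Let normX_lt_r t : 0 < t < T -> `|X t| < r t.
Proof.
move=> tT; have Yt := Ygt0 tT.
by rewrite /radius -sqrtr_sqr ltr_sqrt ?ltrDl ?exprn_gt0// ltr_wpDl ?sqr_ge0 ?exprn_gt0.
Qed.

Let Ugt0 t : 0 < t < T -> 0 < U t.
Proof.
move=> /normX_lt_r; rewrite ltr_norml => /andP[h1 h2].
by rewrite /U sqrtr_gt0 divr_gt0//; lra.
Qed.

Let Vgt0 t : 0 < t < T -> 0 < V t.
Proof.
move=> /normX_lt_r; rewrite ltr_norml => /andP[h1 h2].
by rewrite /V sqrtr_gt0 divr_gt0//; lra.
Qed.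

Let XE t : X t = U t ^+ 2 - V t ^+ 2.
Proof. by rewrite UU VV; field. Qed.

Let rE t : r t = U t ^+ 2 + V t ^+ 2.
Proof. by rewrite UU VV; field. Qed.

(** Positivity of [Y] is what makes the two nonnegative roots the right branch; the squares of both
    sides agree in any case. *)
Let YE t : 0 < t < T -> Y t = 2 * U t * V t.
Proof.
move=> tT; apply/eqP; rewrite -(@eqrXn2 _ 2)//; last 2 first.
- exact/ltW/Ygt0.
- by rewrite !mulr_ge0 ?sqrtr_ge0.
rewrite !exprMn UU VV; apply/eqP.
have -> : Y t ^+ 2 = r t ^+ 2 - X t ^+ 2 by rewrite sqr_radius; ring.
by field.
Qed.

(** Restricted to the open interval: [U] vanishes at [T] and [V] at 0, where the square root is not
    differentiable. Rolle's theorem will only ask for continuity there. *)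
Let dU t : 0 < t < T -> is_derive t 1 U ((P t * U t + Q t * V t) / (2 * r t)).
Proof.
move=> tT; have tT' := le_ooW tT; have dXt := dX tT'; have drt := dr tT'.
have g0 : 0 < (r t + X t) / 2 by rewrite -UU exprn_gt0// Ugt0.
have hg : is_derive t 1 (fun t => (r t + X t) / 2)
    (((X t * P t + Y t * Q t) / r t + P t) / 2).
  by apply: is_derive_eq; rewrite /GRing.scale/=; ring.
have h := @is_derive_sqrt_comp (fun t => (r t + X t) / 2) _ _ g0 hg.
apply: is_derive_eq h _; rewrite -/(U t) (YE tT) XE rE.
have rn0 : U t ^+ 2 + V t ^+ 2 != 0 by rewrite -rE r0.
by field; rewrite rn0 gt_eqF// Ugt0.
Qed.

Let dV t : 0 < t < T -> is_derive t 1 V ((Q t * U t - P t * V t) / (2 * r t)).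
Proof.
move=> tT; have tT' := le_ooW tT; have dXt := dX tT'; have drt := dr tT'.
have g0 : 0 < (r t - X t) / 2 by rewrite -VV exprn_gt0// Vgt0.
have hg : is_derive t 1 (fun t => (r t - X t) / 2)
    (((X t * P t + Y t * Q t) / r t - P t) / 2).
  by apply: is_derive_eq; rewrite /GRing.scale/=; ring.
have h := @is_derive_sqrt_comp (fun t => (r t - X t) / 2) _ _ g0 hg.
apply: is_derive_eq h _; rewrite -/(V t) (YE tT) XE rE.
have rn0 : U t ^+ 2 + V t ^+ 2 != 0 by rewrite -rE r0.
by field; rewrite rn0 gt_eqF// Vgt0.
Qed.

Let cr : {within `[0, T], continuous r}.
Proof. exact: is_derive_within_continuous dr. Qed.

Let cX : {within `[0, T], continuous X}.
Proof. exact: is_derive_within_continuous dX. Qed.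

Let cU : {within `[0, T], continuous U}.
Proof.
move=> t; apply: continuous_comp; last exact: sqrt_continuous.
by apply: cvgM; [apply: cvgD; [exact: cr|exact: cX]|exact: cvg_cst].
Qed.

Let cV : {within `[0, T], continuous V}.
Proof.
move=> t; apply: continuous_comp; last exact: sqrt_continuous.
by apply: cvgM; [apply: cvgB; [exact: cr|exact: cX]|exact: cvg_cst].
Qed.

(* The regularized time [tau], with [d tau = dt / r]. *)
Let regularized_time : exists tau : R -> R,
  [/\ tau 0 = 0, 0 < tau T,
      forall t : R, 0 <= t <= T -> is_derive t 1 tau (r t)^-1 &
      forall t, 0 < t < T -> 0 < tau t < tau T].
Proof.
have cri : continuous (fun t => (r (Num.max 0 (Num.min t T)))^-1).
  move=> t; apply: cvgV; last exact: (continuous_clamp (ltW T0) cr).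
  by apply: r0; rewrite le_max lexx/= ge_max ltW//= ge_min lexx orbT.
have [G [S [_ dG]]] := double_primitive cri.
have dtau t : 0 <= t <= T -> is_derive t 1 (fun t => G t - G 0) (r t)^-1.
  move=> /andP[t0 tT]; have [dGt _] := dG t ltac:(lra).
  by apply: is_derive_eq; rewrite subr0 (min_idPl tT) (max_idPr t0).
have mono s t : 0 <= s < t -> t <= T -> G s < G t.
  move=> /andP[s0 st] tT.
  have dst z : s <= z <= t -> is_derive z 1 (fun t => G t - G 0) (r z)^-1.
    by move=> /andP[sz zt]; apply: dtau; rewrite (le_trans s0)// (le_trans zt).
  have [z zst E] := MVT st (fun z (h : z \in `]s, t[) => dst z ltac:(by move: h; rewrite in_itv/= => /andP[? ?]; rewrite !ltW)) (is_derive_within_continuous dst).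
  have : 0 < G t - G 0 - (G s - G 0).
    rewrite E mulr_gt0 ?subr_gt0// invr_gt0 rgt0//.
    by move: zst; rewrite in_itv/= => /andP[sz zt]; rewrite (le_trans s0 (ltW sz)) (le_trans (ltW zt)).
  lra.
exists (fun t => G t - G 0); split => //; first by rewrite subrr.
  by rewrite subr_gt0 mono// lexx T0.
move=> t /andP[t0 tT]; rewrite subr_gt0 ltrD2r !mono ?lexx ?t0 ?tT ?ltW//.
Qed.

Lemma no_half_turn : False.
Proof.
have [tau [tau0 tauT dtau tau_in]] := regularized_time.
(* With this [k], [cos (k tau)] satisfies the end conditions of [U] and [sin (k tau)] those of [V],
   so both Wronskians vanish at both ends. *)
pose k := pi / 2 / tau T.
have k0 : 0 < k by rewrite /k !divr_gt0// pi_gt0.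
pose th t := k * tau t.
have th0 : th 0 = 0 by rewrite /th tau0 mulr0.
have thT : th T = pi / 2 by rewrite /th /k divfK// gt_eqF.
have th_in t : 0 < t < T -> 0 < th t < pi / 2.
  move=> /tau_in /andP[a b]; rewrite -thT /th mulr_gt0//=.
  by rewrite ltr_pM2l.
have dth t : 0 <= t <= T -> is_derive t 1 th (k / r t).
  by move=> /dtau h; apply: is_derive_eq; rewrite /GRing.scale/=; ring.
have cth : {within `[0, T], continuous th} := is_derive_within_continuous dth.
have cP : {within `[0, T], continuous P} := is_derive_within_continuous dP.
have cQ : {within `[0, T], continuous Q} := is_derive_within_continuous dQ.
have dcos t : 0 <= t <= T -> is_derive t 1 (fun t => cos (th t)) (- sin (th t) * (k / r t)).
  by move=> /dth h; exact: (@is_derive1_comp _ (@cos R) th).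
have dsin t : 0 <= t <= T -> is_derive t 1 (fun t => sin (th t)) (cos (th t) * (k / r t)).
  by move=> /dth h; exact: (@is_derive1_comp _ (@sin R) th).
have ccos : {within `[0, T], continuous (fun t => cos (th t))} := is_derive_within_continuous dcos.
have csin : {within `[0, T], continuous (fun t => sin (th t))} := is_derive_within_continuous dsin.
have V00 : V 0 = 0.
  have : V 0 ^+ 2 == 0 by rewrite VV /radius Y0 expr0n addr0 sqrtr_sqr gtr0_norm// subrr mul0r.
  by rewrite sqrf_eq0 => /eqP.
have UT0 : U T = 0.
  have : U T ^+ 2 == 0 by rewrite UU /radius YT expr0n addr0 sqrtr_sqr ltr0_norm// addNr mul0r.
  by rewrite sqrf_eq0 => /eqP.
pose h := energy 0.
have hE t : 0 <= t <= T -> 2^-1 * (P t ^+ 2 + Q t ^+ 2) = h + (r t)^-1 + X t.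
  by move=> tT; rewrite /h -(energy_cst tT) /energy; ring.
(* Derivatives with respect to [tau]: [U' = (P U + Q V) / 2], [V' = (Q U - P V) / 2],
   [U'' = (h / 2 + U^2) U] and [V'' = (h / 2 - V^2) V]. [W1] and [W2] are the
   Wronskians of [U], [V] with [cos (k tau)], [sin (k tau)]. *)
pose W1 t := (P t * U t + Q t * V t) / 2 * cos (th t) + k * U t * sin (th t).
pose W2 t := (Q t * U t - P t * V t) / 2 * sin (th t) - k * V t * cos (th t).
have dW1 t : 0 < t < T -> is_derive t 1 W1 (U t / r t * (U t ^+ 2 + h / 2 + k ^+ 2) * cos (th t)).
  move=> tT; have tT' := le_ooW tT.
  have dPt := dP tT'; have dQt := dQ tT'; have dUt := dU tT; have dVt := dV tT.
  have dct := dcos _ tT'; have dst := dsin _ tT'.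
  apply: is_derive_eq; rewrite /GRing.scale/=.
  have -> : h = 2^-1 * (P t ^+ 2 + Q t ^+ 2) - (r t)^-1 - X t by rewrite (hE _ tT'); ring.
  rewrite (YE tT) XE rE.
  have rn0 : U t ^+ 2 + V t ^+ 2 != 0 by rewrite -rE r0.
  by field.
have dW2 t : 0 < t < T -> is_derive t 1 W2 (V t / r t * (h / 2 - V t ^+ 2 + k ^+ 2) * sin (th t)).
  move=> tT; have tT' := le_ooW tT.
  have dPt := dP tT'; have dQt := dQ tT'; have dUt := dU tT; have dVt := dV tT.
  have dct := dcos _ tT'; have dst := dsin _ tT'.
  apply: is_derive_eq; rewrite /GRing.scale/=.
  have -> : h = 2^-1 * (P t ^+ 2 + Q t ^+ 2) - (r t)^-1 - X t by rewrite (hE _ tT'); ring.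
  rewrite (YE tT) XE rE.
  have rn0 : U t ^+ 2 + V t ^+ 2 != 0 by rewrite -rE r0.
  by field.
have cW1 : {within `[0, T], continuous W1}.
  move=> t; apply: cvgD; apply: cvgM; [|exact: ccos| |exact: csin].
    apply: cvgM; last exact: cvg_cst.
    by apply: cvgD; apply: cvgM; [exact: cP|exact: cU|exact: cQ|exact: cV].
  by apply: cvgM; [exact: cvg_cst|exact: cU].
have cW2 : {within `[0, T], continuous W2}.
  move=> t; apply: cvgB; apply: cvgM; [|exact: csin| |exact: ccos].
    apply: cvgM; last exact: cvg_cst.
    by apply: cvgB; apply: cvgM; [exact: cQ|exact: cU|exact: cP|exact: cV].
  by apply: cvgM; [exact: cvg_cst|exact: cV].
have W1E : W1 0 = W1 T.
  by rewrite /W1 P0 V00 UT0 th0 thT sin0 cos_pihalf !(mulr0, mul0r, addr0).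
have W2E : W2 0 = W2 T.
  by rewrite /W2 PT V00 UT0 th0 thT sin0 cos_pihalf !(mulr0, mul0r, addr0, subr0).
(* At an interior critical point of [W1] the positive factors cancel, leaving [U^2 + h/2 + k^2 = 0].
   For [W2] the same argument leaves [h/2 - V^2 + k^2 = 0]. *)
have neg : h / 2 + k ^+ 2 < 0.
  have [s] := Rolle T0 (fun s (hs : s \in `]0, T[) => @ex_derive _ _ _ _ _ _ _ (dW1 s ltac:(by move: hs; rewrite in_itv))) cW1 W1E.
  rewrite in_itv/= => sT [_ D0]; have [_ D1] := dW1 _ sT.
  have /eqP := etrans (esym D1) D0.
  have /andP[ts0 ts1] := th_in _ sT.
  rewrite mulf_eq0 (gt_eqF (cos_gt0_pihalf _)) ?orbF; last first.
    by rewrite ts1 andbT (lt_trans _ ts0)// oppr_lt0 divr_gt0// pi_gt0.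
  rewrite mulf_eq0 (gt_eqF (divr_gt0 (Ugt0 sT) (rgt0 (le_ooW sT))))/= => /eqP E.
  have : 0 < U s ^+ 2 by rewrite exprn_gt0// Ugt0.
  lra.
have pos : 0 < h / 2 + k ^+ 2.
  have [s] := Rolle T0 (fun s (hs : s \in `]0, T[) => @ex_derive _ _ _ _ _ _ _ (dW2 s ltac:(by move: hs; rewrite in_itv))) cW2 W2E.
  rewrite in_itv/= => sT [_ D0]; have [_ D1] := dW2 _ sT.
  have /eqP := etrans (esym D1) D0.
  have /andP[ts0 ts1] := th_in _ sT.
  rewrite mulf_eq0 (gt_eqF (sin_gt0_pi _)) ?orbF; last first.
    by rewrite ts0 (lt_trans ts1)//; have := pi_gt0 R; lra.
  rewrite mulf_eq0 (gt_eqF (divr_gt0 (Vgt0 sT) (rgt0 (le_ooW sT))))/= => /eqP E.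
  have : 0 < V s ^+ 2 by rewrite exprn_gt0// Vgt0.
  lra.
by move: (lt_trans neg pos); rewrite ltxx.
Qed.

End parabolic_coordinates.

(** * Every minimizer collides *)

Section no_collision_free_minimizer.
Context {R : realType}.
Local Notation mu := (@lebesgue_measure R).

(** Meant for a function known to be constant on one side of [t] only: differentiability at [t]
    makes that side decide. *)
Lemma is_derive_eq0_frequently (w : R -> R) (t D : R) : is_derive t 1 w D ->
  (forall e, 0 < e -> exists h, [/\ h != 0, `|h| < e & w (t + h) = w t]) -> D = 0.
Proof.
move=> [dw wD] hw; apply/eqP/negPn/negP => D0.
have c : (fun h => h^-1 *: ((w \o shift t) (h *: 1) - w t)) @ (0 : R)^' --> D.
  by rewrite -wD; exact: dw.
have : \forall h \near (0 : R)^', `|D - h^-1 *: ((w \o shift t) (h *: 1) - w t)| < `|D|.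
  by move/cvgrPdist_lt : c; apply; rewrite normr_gt0.
move=> /nbhs_ballP[e /= e0 he].
have [h [h0 he' wh]] := hw _ e0.
have := he h; rewrite /ball/= sub0r normrN => /(_ he' h0).
rewrite /shift/= [_ *: 1]mulr1 (addrC h) wh subrr scaler0 subr0 ltxx.
by [].
Qed.

(** Gronwall: [E = Y^2 + P^2] satisfies [|E'| <= (1 + m) E]. As [t1] may be interior, [E] is
    propagated backwards with the weight [expR (K * t)] and forwards with [expR (- K * t)]. *)
Lemma linear_ode_zero (T m t1 : R) (Y P g : R -> R) : 0 < m ->
  (forall t : R, 0 <= t <= T -> is_derive t 1 Y (P t)) ->
  (forall t : R, 0 <= t <= T -> is_derive t 1 P (- Y t * g t)) ->
  (forall t, 0 <= t <= T -> 0 <= g t <= m) ->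
  0 <= t1 <= T -> Y t1 = 0 -> P t1 = 0 ->
  forall t, 0 <= t <= T -> Y t = 0.
Proof.
move=> m0 dY dP gm /andP[t10 t1T] Y1 P1.
pose E t := Y t ^+ 2 + P t ^+ 2.
have E0 t : 0 <= E t by rewrite addr_ge0 ?sqr_ge0.
pose K := 1 + m.
have Ebound t : 0 <= t <= T -> `|2 * (Y t * P t) * (1 - g t)| <= K * E t.
  move=> /gm /andP[g0 g1]; rewrite normrM mulrC; apply: ler_pM => //.
    by rewrite /K ler_norml; apply/andP; split; lra.
  rewrite /E ler_norml; apply/andP; split.
    by have := sqr_ge0 (Y t + P t); nra.
  by have := sqr_ge0 (Y t - P t); nra.
have dE (c t : R) : 0 <= t <= T -> is_derive t 1 (fun t => E t * expR (c * t))
    ((2 * (Y t * P t) * (1 - g t) + c * E t) * expR (c * t)).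
  move=> tT; have dYt := dY _ tT; have dPt := dP _ tT.
  have de : is_derive t 1 (fun t => expR (c * t)) (expR (c * t) * c).
    apply: (@is_derive1_comp _ (@expR R) (fun t => c * t)).
    by apply: is_derive_eq; rewrite /GRing.scale/=; ring.
  by apply: is_derive_eq; rewrite /GRing.scale/= /E; ring.
have E1 : E t1 = 0 by rewrite /E Y1 P1 expr0n addr0.
have suffE t : E t <= 0 -> Y t = 0.
  move=> Et; have : Y t ^+ 2 == 0.
    by rewrite eq_le sqr_ge0 andbT (le_trans _ Et)// lerDl sqr_ge0.
  by rewrite sqrf_eq0 => /eqP.
move=> t /[dup] tT /andP[t0 tT']; apply: suffE.
have [tt1|tt1|->] := ltgtP t t1; last by rewrite E1.
  have d z : t <= z <= t1 -> is_derive z 1 (fun t => E t * expR (K * t))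
      ((2 * (Y z * P z) * (1 - g z) + K * E z) * expR (K * z)).
    by move=> /andP[tz zt]; apply: dE; rewrite (le_trans t0)// (le_trans zt).
  have [z zt] := MVT tt1 (fun z (h : z \in `]t, t1[) => d z ltac:(by move: h; rewrite in_itv/= => /andP[? ?]; rewrite !ltW)) (is_derive_within_continuous d).
  move: zt; rewrite in_itv/= => /andP[tz zt] Ez.
  have : 0 <= E t1 * expR (K * t1) - E t * expR (K * t).
    rewrite Ez mulr_ge0//; last by rewrite subr_ge0 ltW.
    rewrite mulr_ge0 ?expR_ge0//.
    have := Ebound z; rewrite (le_trans t0 (ltW tz)) (le_trans (ltW zt))//= => /(_ isT).
    by rewrite ler_norml => /andP[? _]; lra.
  rewrite E1 mul0r sub0r oppr_ge0; have := expR_gt0 (K * t).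
  by move=> e0 /[!pmulr_lle0].
have d z : t1 <= z <= t -> is_derive z 1 (fun t => E t * expR (- K * t))
    ((2 * (Y z * P z) * (1 - g z) + - K * E z) * expR (- K * z)).
  by move=> /andP[tz zt]; apply: dE; rewrite (le_trans t10)// (le_trans zt).
have [z zt] := MVT tt1 (fun z (h : z \in `]t1, t[) => d z ltac:(by move: h; rewrite in_itv/= => /andP[? ?]; rewrite !ltW)) (is_derive_within_continuous d).
move: zt; rewrite in_itv/= => /andP[tz zt] Ez.
have : E t * expR (- K * t) - E t1 * expR (- K * t1) <= 0.
  rewrite Ez mulr_le0_ge0//; last by rewrite subr_ge0 ltW.
  rewrite mulr_le0_ge0 ?expR_ge0//.
  have := Ebound z; rewrite (le_trans t10 (ltW tz)) (le_trans (ltW zt))//= => /(_ isT).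
  by rewrite ler_norml => /andP[_ ?]; lra.
rewrite E1 mul0r subr0; have := expR_gt0 (- K * t).
by move=> e0 /[!pmulr_lle0].
Qed.

Lemma H1_deriv_flip (T t1 : R) (y v : R -> R) : 0 <= t1 <= T -> y t1 = 0 -> H1_deriv T y v ->
  H1_deriv T (fun t => if t <= t1 then y t else - y t) (fun t => if t <= t1 then v t else - v t).
Proof.
move=> /andP[t10 t1T] y1 yv; have [[mv iv] yE] := (H1_derivP _ _ _).1 yv.
have mle : measurable_fun `[0, T]%classic (fun t : R => t <= t1).
  by apply: measurable_fun_ler => //; exact: measurable_id.
have Lf : L2 T (fun t => if t <= t1 then v t else - v t).
  apply: (@L2_sub _ _ _ v) => //.
    apply: measurable_fun_if => //; first exact: measurable_funS mv.
    by apply: measurable_funS (measurable_funN mv) => //.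
  by move=> t _; case: ifP => // _; rewrite normrN.
apply/H1_derivP; split => // t /[dup] tT /andP[t0 tT'].
have If := L2_integrable Lf; have Iv := L2_integrable (conj mv iv : L2 T v).
rewrite t10; case: (leP t t1) => tt1.
  rewrite (yE _ tT); congr (_ + _); apply: eq_Rintegral => s.
  by rewrite inE/= in_itv/= => /andP[_ st]; rewrite (le_trans st).
rewrite (Rintegral_split (b := t1)); last 2 first.
- exact: integrable_subitv If (lexx _) _.
- by rewrite t10 ltW.
have -> : Rintegral mu `[0, t1]%classic (fun t => if t <= t1 then v t else - v t) = - y 0.
  have := yE t1; rewrite t10 t1T y1 => /(_ isT)/esym/eqP; rewrite addrC addr_eq0 => /eqP <-.
  by apply: eq_Rintegral => s; rewrite inE/= in_itv/= => /andP[_ ->].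
rewrite addrA subrr add0r.
have -> : Rintegral mu `[t1, t]%classic (fun t => if t <= t1 then v t else - v t) =
    Rintegral mu `[t1, t]%classic (fun t => -1 * v t).
  rewrite -(@Rintegral_itv_obnd_cbnd _ t1 (BRight t)); last first.
    by apply: integrableS If => //; apply: subset_itv; rewrite bnd_simp.
  rewrite -[RHS](@Rintegral_itv_obnd_cbnd _ t1 (BRight t)); last first.
    by apply: integrableS (integrable_scale (-1) _ Iv) => //; apply: subset_itv; rewrite bnd_simp.
  apply: eq_Rintegral => s; rewrite inE/= in_itv/= => /andP[ts _].
  by rewrite leNgt ts mulN1r.
rewrite RintegralZl//; last exact: integrable_subitv Iv t10 tT'.
have tt : 0 <= t1 <= t by rewrite t10 ltW.
by rewrite (H1_deriv_increment yv tt tT') y1 add0r mulN1r.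
Qed.

Lemma minimizer_flip (T t1 : R) (x y : R -> R) : 0 < T -> 0 < t1 < T -> y t1 = 0 ->
  minimizer T x y -> minimizer T x (fun t => if t <= t1 then y t else - y t).
Proof.
move=> T0 /andP[t10 t1T] y1 [[[u xu] [[v yv] [y0 [yT [x0 xT]]]]] mini].
have t1T' : 0 <= t1 <= T by rewrite !ltW.
have yv' := H1_deriv_flip t1T' y1 yv.
split.
  split; first by exists u.
  split; first by exists (fun t => if t <= t1 then v t else - v t).
  by rewrite (ltW t10) y0 leNgt t1T/= yT oppr0.
have -> : action T x (fun t => if t <= t1 then y t else - y t) = action T x y => //.
rewrite (actionE T0 xu yv) (actionE T0 xu yv'); apply: eq_integral => t _.
rewrite /inv_radius /radius; case: ifP => // _.
by rewrite !sqrrN oppr_eq0.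
Qed.

Lemma constant_sign (T : R) (f : R -> R) : {within `[0, T], continuous f} ->
  (forall t, 0 < t < T -> f t != 0) -> 0 < f (T / 2) ->
  forall t, 0 < t < T -> 0 < f t.
Proof.
move=> cf f0 fT t tT; rewrite ltNge; apply/negP => ft.
have [t0 tT'] := andP tT.
have [a [b [ab a0 bT fab]]] : exists a b, [/\ a <= b, 0 < a, b < T &
    Num.min (f a) (f b) <= 0 <= Num.max (f a) (f b)].
  have [h|h] := leP t (T / 2).
    by exists t, (T / 2); split => //; [lra|rewrite ge_min ft le_max (ltW fT) orbT].
  by exists (T / 2), t; split; [exact: ltW|lra|exact: tT'|rewrite ge_min ft orbT le_max (ltW fT)].
have sab : `[a, b]%classic `<=` `[0, T]%classic.
  by apply: subset_itv; rewrite bnd_simp ltW.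
have [c] := IVT ab (continuous_subspaceW sab cf) fab.
rewrite in_itv/= => /andP[ac cb] /eqP; apply/negP/f0.
by rewrite (lt_le_trans a0)//= (le_lt_trans cb).
Qed.

Lemma minimizer_collides (T : R) (x y : R -> R) : 0 < T -> minimizer T x y ->
  exists2 c, 0 <= c <= T & radius x y c = 0.
Proof.
move=> T0 mxy; apply: contrapT => noc.
have r0 t : 0 <= t <= T -> radius x y t != 0.
  by move=> tT; apply/eqP => rt; apply: noc; exists t.
have [[[u xu] [[v yv] [y0 [yT [x0 xT]]]]] mini] := mxy.
have T00 : (0 : R) <= 0 <= T by rewrite lexx ltW.
have TT0 : 0 <= T <= T by rewrite lexx ltW.
have {}x0 : 0 < x 0.
  by rewrite lt_neqAle x0 andbT; have := r0 _ T00; rewrite radius_eq0 y0 eqxx andbT eq_sym.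
have {}xT : x T < 0.
  by rewrite lt_neqAle xT andbT; have := r0 _ TT0; rewrite radius_eq0 yT eqxx andbT.
have cx := H1_deriv_continuous T0 xu; have cy := H1_deriv_continuous T0 yv.
have [m m0 far] := radius_lower_bound (ltW T0) cx cy r0.
have [X [P [dXP PT xX]]] := minimizer_equation_x T0 mxy xu yv (lexx 0) T0 m0 far xT.
have [Y [Q [dYQ yY]]] := minimizer_equation_y T0 mxy xu yv (lexx 0) T0 m0 far erefl.
have tN1 (t : R) : 0 <= t <= T -> -1 < t by move=> /andP[? _]; lra.
(* The total force in [x] is zero, hence [P T - P 0 = 0]. *)
have P0 : P 0 = 0.
  have dP t : 0 <= t <= T -> is_derive t 1 P (force_x T x y 0 t).
    by move=> /tN1 /dXP[].
  have := FTC_Rintegral (ltW T0) dP (continuous_force_x T0 xu yv (lexx 0) T0 m0 far).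
  rewrite (minimizer_equation_x0 T0 mxy xu yv (lexx 0) T0 m0 far erefl x0 xT) PT sub0r.
  by move=> /esym/eqP; rewrite oppr_eq0 => /eqP.
have dY t : 0 <= t <= T -> is_derive t 1 Y (Q t) by move=> /tN1 /dYQ[].
have dQ t : 0 <= t <= T -> is_derive t 1 Q (- y t / radius x y t ^+ 3).
  by move=> tT; have [_ d] := dYQ _ (tN1 _ tT); apply: is_derive_eq d _; rewrite /force_y clamp_id.
have yn0 t : 0 < t < T -> y t != 0.
  move=> t1T; apply/eqP => yt.
  have [t0 tT] := andP t1T.
  pose yf s := if s <= t then y s else - y s.
  have mf := minimizer_flip T0 t1T yt mxy.
  have yvf := H1_deriv_flip (introT andP (conj (ltW t0) (ltW tT))) yt yv.
  have rf s : radius x yf s = radius x y s.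
    by rewrite /radius /yf; case: ifP => // _; rewrite sqrrN.
  have farf s : 0 <= s <= T -> m <= radius x yf s by rewrite rf; exact: far.
  have [Yf [Qf [dYQf yYf]]] := minimizer_equation_y T0 mf xu yvf (lexx 0) T0 m0 farf erefl.
  have dYt := dY t ltac:(by rewrite !ltW).
  have [dYft _] := dYQf t ltac:(lra).
  have yf1 : yf t = 0 by rewrite /yf lexx.
  (* [Y] and [Yf] are both differentiable at [t]; they agree before [t] and are opposite after it.
     So [Q t] equals both [Qf t] and [- Qf t]. *)
  have Q1 : Q t - Qf t = 0.
    apply: (@is_derive_eq0_frequently (fun s => Y s - Yf s) t).
    move=> e e0; exists (- Num.min (e / 2) t); split.
    - by rewrite oppr_eq0 gt_eqF// lt_min t0 divr_gt0.
    - rewrite normrN gtr0_norm ?lt_min ?t0 ?divr_gt0//.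
      by rewrite gt_min; apply/orP; left; lra.
    - set h := Num.min _ _.
      have h0 : 0 < h by rewrite lt_min t0 divr_gt0.
      have ht : h <= t by rewrite ge_min lexx orbT.
      rewrite -yY -?yYf; [|lra..].
      rewrite -yY -?yYf; [|lra..].
      by rewrite /yf lexx subrr ifT ?subrr//; lra.
  have Q2 : Q t + Qf t = 0.
    apply: (@is_derive_eq0_frequently (fun s => Y s + Yf s) t).
    move=> e e0; exists (Num.min (e / 2) (T - t)); split.
    - by rewrite gt_eqF// lt_min subr_gt0 tT divr_gt0.
    - rewrite gtr0_norm ?lt_min ?subr_gt0 ?tT ?divr_gt0//.
      by rewrite gt_min; apply/orP; left; lra.
    - set h := Num.min _ _.
      have h0 : 0 < h by rewrite lt_min subr_gt0 tT divr_gt0.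
      have ht : h <= T - t by rewrite ge_min lexx orbT.
      rewrite -yY -?yYf; [|lra..].
      rewrite -yY -?yYf; [|lra..].
      by rewrite /yf lexx yt addr0 leNgt ltrDl h0/= subrr.
  have Qt : Q t = 0 by lra.
  have Y0 s : 0 <= s <= T -> Y s = 0.
    apply: (@linear_ode_zero T (m ^+ 3)^-1 t Y Q (fun s => (radius x y s ^+ 3)^-1)) => //.
    - by rewrite invr_gt0 exprn_gt0.
    - by move=> z zT; rewrite -yY//; exact: dQ.
    - move=> z zT; have mz := far _ zT.
      rewrite invr_ge0 exprn_ge0 ?radius_ge0//= lef_pV2 ?posrE ?exprn_gt0// ?(lt_le_trans m0 mz)//.
      by rewrite lerXn2r ?nnegrE ?radius_ge0// ltW.
    - by rewrite !ltW.
    - by rewrite -yY ?yt// !ltW.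
  (* With [y] identically zero, the sign change of [x] is a collision. *)
  have [c] := IVT (v := 0) (ltW T0) cx ltac:(by rewrite ge_min (ltW xT) orbT le_max (ltW x0)).
  rewrite in_itv/= => cT xc; have := r0 _ cT; rewrite radius_eq0 xc eqxx/=.
  by rewrite (yY _ cT) (Y0 _ cT) eqxx.
have rX t : 0 <= t <= T -> radius X Y t = radius x y t.
  by move=> tT; rewrite /radius -xX// -yY.
have rX' t : 0 <= t <= T -> radius X (fun s => - Y s) t = radius x y t.
  by move=> tT; rewrite /radius sqrrN -xX// -yY.
have dX t : 0 <= t <= T -> is_derive t 1 X (P t) by move=> /tN1 /dXP[].
have dP t : 0 <= t <= T -> is_derive t 1 P (1 - x t / radius x y t ^+ 3).
  by move=> tT; have [_ d] := dXP _ (tN1 _ tT); apply: is_derive_eq d _; rewrite /force_x clamp_id.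
have T2 : 0 < T / 2 < T by apply/andP; split; lra.
have [yT2|yT2] := ltP 0 (y (T / 2)).
  have ypos := constant_sign cy yn0 yT2.
  apply: (@no_half_turn R T X Y P Q) => //.
  - by move=> t tT; rewrite rX// r0.
  - by move=> t tT; rewrite rX// -xX//; exact: dP.
  - by move=> t tT; rewrite rX// -yY//; exact: dQ.
  - by rewrite -yY.
  - by rewrite -yY.
  - by rewrite -xX.
  - by rewrite -xX.
  - by move=> t /[dup] tT /andP[? ?]; rewrite -yY ?ypos// !ltW.
(* When [y] is negative inside, the same exclusion applies to the mirror image in the [x]-axis. *)
have cNy : {within `[0, T], continuous (fun t => - y t)}.
  by move=> t; apply: cvgN; exact: cy.
have yneg := constant_sign cNy.
have {}yneg t : 0 < t < T -> 0 < - y t.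
  apply: yneg; first by move=> s /yn0; rewrite oppr_eq0.
  by rewrite oppr_gt0 lt_neqAle yT2 andbT yn0.
apply: (@no_half_turn R T X (fun t => - Y t) P (fun t => - Q t)) => //.
- by move=> t tT; rewrite rX'// r0.
- by move=> t tT; rewrite rX'// -xX//; exact: dP.
- by move=> t tT; have dYt := dY _ tT; exact: is_deriveN.
- move=> t tT; have dQt := dQ _ tT.
  by apply: is_derive_eq; rewrite rX'// -yY//; ring.
- by rewrite -yY// y0 oppr0.
- by rewrite -yY// yT oppr0.
- by rewrite -xX.
- by rewrite -xX.
- by move=> t /[dup] tT /andP[? ?]; rewrite -yY ?yneg// !ltW.
Qed.

End no_collision_free_minimizer.

(** * Reflection of the half-orbit at time [T] *)

Section reflection.
Context {R : realType}.

Lemma is_derive_glue (T d : R) (f g : R -> R) : f T = g T ->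
  is_derive T 1 f d -> is_derive T 1 g d ->
  is_derive T 1 (fun s => if s <= T then f s else g s) d.
Proof.
move=> fgT [df fd] [dg gd].
pose q (w : R -> R) (h : R) := h^-1 *: ((w \o shift T) (h *: 1) - w T).
have cf : q f @ (0 : R)^' --> d by rewrite -fd; exact: df.
have cg : q g @ (0 : R)^' --> d by rewrite -gd; exact: dg.
have c : q (fun s => if s <= T then f s else g s) @ (0 : R)^' --> d.
  apply/cvgrPdist_lt => e e0.
  move/cvgrPdist_lt : cf => /(_ e e0) cf; move/cvgrPdist_lt : cg => /(_ e e0) cg.
  near=> h; rewrite /q /= lexx; case: ifP => _.
    by near: h; exact: cf.
  by rewrite fgT; near: h; exact: cg.
split; first by apply/cvg_ex; exists d.
exact: cvg_lim c.
Unshelve. all: by end_near. Qed.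

Lemma is_derive_if (T s : R) (f g df dg : R -> R) : f T = g T -> df T = dg T ->
  (s <= T -> is_derive s 1 f (df s)) -> (T <= s -> is_derive s 1 g (dg s)) ->
  is_derive s 1 (fun s => if s <= T then f s else g s) (if s <= T then df s else dg s).
Proof.
move=> fgT dfgT hf hg; case: (ltgtP s T) hf hg => [sT /(_ isT) hf _|sT _ /(_ isT) hg|-> /(_ isT) hf /(_ isT) hg].
- apply: near_eq_is_derive hf; near=> z; rewrite ifT//.
  by apply/ltW; near: z; exact: lt_nbhsl.
- apply: near_eq_is_derive hg; near=> z; rewrite ifF//; apply/negbTE; rewrite -ltNge.
  by near: z; exact: lt_nbhsr.
- by apply: is_derive_glue => //; rewrite dfgT.
Unshelve. all: by end_near. Qed.

Lemma is_derive_reflect (T s df : R) (f : R -> R) : is_derive (2 * T - s) 1 f df ->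
  is_derive s 1 (fun s => f (2 * T - s)) (- df).
Proof.
move=> hf; have h : is_derive s 1 (fun s => 2 * T - s) (-1).
  by apply: is_derive_eq; rewrite /GRing.scale/=; ring.
by rewrite -mulrN1; exact: (@is_derive1_comp _ f (fun s => 2 * T - s)).
Qed.

(** On [[0, 2 * T]] the reflection is [f] composed with the tent map [min t (2 * T - t)]. *)
Lemma reflect_ext_continuous (T : R) (f : R -> R) : 0 <= T ->
  {within `[0, T], continuous f} -> {within `[0, 2 * T], continuous (reflect_ext T f)}.
Proof.
move=> T0 /(continuous_clamp T0) cf.
have : {within `[0, 2 * T], continuous (fun t => f (Num.max 0 (Num.min (Num.min t (2 * T - t)) T)))}.
  apply: continuous_subspaceT => t.
  apply: (@continuous_comp _ _ _ (fun t : R => Num.min t (2 * T - t)) (fun t => f (Num.max 0 (Num.min t T)))).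
    apply: (@continuous_min _ _ id (fun t => 2 * T - t)); first exact: cvg_id.
    by apply: cvgB; [exact: cvg_cst|exact: cvg_id].
  exact: cf.
apply: subspace_eq_continuous => t; rewrite inE/= in_itv/= => /andP[t0 tT].
rewrite /reflect_ext /from_subspace; case: (leP t T) => tT'.
  have h : t <= 2 * T - t by lra.
  by rewrite (min_idPl h) (min_idPl tT') (max_idPr t0).
have h : 2 * T - t <= t by lra.
have h1 : 2 * T - t <= T by lra.
have h2 : 0 <= 2 * T - t by lra.
by rewrite (min_idPr h) (min_idPl h1) (max_idPr h2).
Qed.

Lemma reflect_ext_zero (T t : R) (y : R -> R) : 0 < t < 2 * T ->
  (forall s, 0 <= s <= T -> y s = 0) ->
  [/\ reflect_ext T y t = 0, derivable (reflect_ext T y) t 1,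
      derivable (derive1 (reflect_ext T y)) t 1 &
      derive1 (derive1 (reflect_ext T y)) t = 0].
Proof.
move=> /andP[t0 tT] y0.
have Y0 s : 0 < s < 2 * T -> reflect_ext T y s = 0.
  by move=> /andP[s0 sT]; rewrite /reflect_ext; case: (leP s T) => h; apply: y0; apply/andP; split; lra.
have nearT s : 0 < s < 2 * T -> \forall z \near s, 0 < z < 2 * T.
  move=> /andP[s0 sT]; near=> z; apply/andP; split.
    by near: z; exact: lt_nbhsr.
  by near: z; exact: lt_nbhsl.
have d1 s : 0 < s < 2 * T -> is_derive s 1 (reflect_ext T y) 0.
  move=> /nearT h; apply: (near_eq_is_derive (f := cst 0)) => //.
  by apply: filterS h => z /Y0 ->.
have d2 : is_derive t 1 (derive1 (reflect_ext T y)) 0.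
  apply: (near_eq_is_derive (f := cst 0)) => //.
  have := nearT t; rewrite t0 tT => /(_ isT); apply: filterS => z /d1[_ h].
  by rewrite derive1E h.
split; first by rewrite Y0// t0.
- by have := d1 t; rewrite t0 tT => /(_ isT)[].
- by case: d2.
- by rewrite derive1E; case: d2.
Unshelve. all: by end_near. Qed.

(** Reversing time negates the velocity and keeps the acceleration, so [P T = 0] makes both
    derivatives match at [T]. [X] replaces [x] because it has two-sided derivatives at [T], whereas
    [x] is arbitrary beyond [T]. *)
Lemma reflect_ext_C2 (T d t : R) (x X P F : R -> R) : 0 < d -> d < t < 2 * T - d ->
  (forall s : R, d <= s <= T -> is_derive s 1 X (P s) /\ is_derive s 1 P (F s)) ->
  P T = 0 -> (forall s, d <= s <= T -> x s = X s) ->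
  [/\ derivable (reflect_ext T x) t 1, derivable (derive1 (reflect_ext T x)) t 1 &
      derive1 (derive1 (reflect_ext T x)) t = reflect_ext T F t].
Proof.
move=> d0 /andP[dt tT] dXP PT xX.
pose Z s := if s <= T then X s else X (2 * T - s).
pose Z1 s := if s <= T then P s else - P (2 * T - s).
have TT : 2 * T - T = T by ring.
have nearT s : d < s < 2 * T - d -> \forall z \near s, d < z < 2 * T - d.
  move=> /andP[s0 sT]; near=> z; apply/andP; split.
    by near: z; exact: lt_nbhsr.
  by near: z; exact: lt_nbhsl.
have dZ s : d < s < 2 * T - d -> is_derive s 1 Z (Z1 s).
  move=> /andP[ds sT].
  apply: (@is_derive_if T s X (fun s => X (2 * T - s)) P (fun s => - P (2 * T - s)));
    rewrite ?TT ?PT ?oppr0// => h.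
    by have [] := dXP s ltac:(by rewrite (ltW ds)).
  by apply: is_derive_reflect; have [] := dXP (2 * T - s) ltac:(by apply/andP; split; lra).
have dZ1 s : d < s < 2 * T - d -> is_derive s 1 Z1 (reflect_ext T F s).
  move=> /andP[ds sT].
  apply: (@is_derive_if T s P (fun s => - P (2 * T - s)) F (fun s => F (2 * T - s)));
    rewrite ?TT ?PT ?oppr0// => h.
    by have [] := dXP s ltac:(by rewrite (ltW ds)).
  have [_ h'] := dXP (2 * T - s) ltac:(by apply/andP; split; lra).
  have h2 := is_derive_reflect h'.
  by rewrite -[X in is_derive _ _ _ X]opprK; exact: is_deriveN.
have ZE s : d < s < 2 * T - d -> Z s = reflect_ext T x s.
  move=> /andP[ds sT]; rewrite /Z /reflect_ext; case: (leP s T) => h;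
    by rewrite xX//; apply/andP; split; lra.
have d1 s : d < s < 2 * T - d -> is_derive s 1 (reflect_ext T x) (Z1 s).
  move=> sT; apply: near_eq_is_derive (dZ _ sT).
  by apply: filterS (nearT _ sT) => z /ZE.
have tT' : d < t < 2 * T - d by rewrite dt.
have d2 : is_derive t 1 (derive1 (reflect_ext T x)) (reflect_ext T F t).
  apply: near_eq_is_derive (dZ1 _ tT').
  by apply: filterS (nearT _ tT') => z /d1[_ h]; rewrite derive1E h.
split.
- by case: (d1 _ tT').
- by case: d2.
- by rewrite derive1E; case: d2.
Unshelve. all: by end_near. Qed.

End reflection.

Unset Implicit Arguments.

Theorem theorem1p5 (R : realType) (T : R) (hT : 0 < T) (x y : R -> R) :
  Omega T x y ->
  (forall x' y' : R -> R, Omega T x' y' -> (action T x y <= action T x' y')%E) ->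
  collision_ejection_negx (2 * T) (reflect_ext T x) (reflect_ext T y).
Proof.
move=> xyO mini; have mxy : minimizer T x y by [].
have [[u xu] [[v yv] _]] := xyO.
have [c cT rc] := minimizer_collides hT mxy.
have [x0 y0 xneg xmono] := collision_orbit hT mxy xu yv cT rc.
have T2 : T < 2 * T by lra.
have T00 : (0 : R) <= 0 <= T by rewrite lexx ltW.
split; first by rewrite /reflect_ext ltW.
split; first by rewrite /reflect_ext ltW// y0.
split; first by rewrite /reflect_ext leNgt T2/= subrr.
split; first by rewrite /reflect_ext leNgt T2/= subrr y0.
split; first exact: reflect_ext_continuous (ltW hT) (H1_deriv_continuous hT xu).
split; first exact: reflect_ext_continuous (ltW hT) (H1_deriv_continuous hT yv).
move=> t tT /=; have [t0 tT'] := andP tT.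
have [Y0 dY dY' ddY] := reflect_ext_zero tT y0.
(* Half the distance from [t] to the nearer collision time, so that [[d, T]] contains [t] or its
   mirror image and avoids the collision. *)
pose d := Num.min t (2 * T - t) / 2.
have d0 : 0 < d by rewrite /d divr_gt0// lt_min t0 subr_gt0.
have dt : d < t.
  by rewrite /d ltr_pdivrMr// (@le_lt_trans _ _ t)// ?ge_min ?lexx//; lra.
have dt' : d < 2 * T - t.
  by rewrite /d ltr_pdivrMr// (@le_lt_trans _ _ (2 * T - t))// ?ge_min ?lexx ?orbT//; lra.
have dT : d < T by lra.
have tr : T < t -> 2 * T - t <= T by lra.
clearbody d.
(* Since [x] decreases along the negative axis, [- x d] is the least radius on [[d, T]]. *)
have m0 : 0 < - x d by rewrite oppr_gt0 xneg// d0 ltW.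
have rE s : 0 < s <= T -> radius x y s = - x s.
  move=> /[dup] sT /andP[s0 sT'].
  by rewrite /radius y0 ?(ltW s0)// expr0n addr0 sqrtr_sqr ltr0_norm// xneg.
have far s : d <= s <= T -> - x d <= radius x y s.
  move=> /andP[ds sT]; rewrite rE ?(lt_le_trans d0 ds)// lerN2.
  by apply: xmono => //; rewrite ds ltW.
have xT : x T < 0 by rewrite xneg// hT lexx.
have [X [P [dXP PT xX]]] := minimizer_equation_x hT mxy xu yv (ltW d0) dT m0 far xT.
have [] := @reflect_ext_C2 R T d t x X P (force_x T x y d) d0 _ _ PT xX.
- by rewrite dt ltrBrDl addrC -ltrBrDl.
- move=> s /andP[ds _]; apply: dXP.
  by rewrite (lt_le_trans _ ds)// (lt_trans _ d0)// oppr_lt0.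
move=> dX dX' ddX; split => //; split.
  rewrite /reflect_ext; case: (leP t T) => tT1; apply: xneg; first by rewrite t0.
  by rewrite (lt_trans d0 dt') tr.
do 4 split => //; split; last by rewrite ddY Y0 oppr0 mul0r.
rewrite ddX Y0 /reflect_ext; case: (leP t T) => tT1.
  rewrite /force_x clamp_id; last by rewrite (ltW dt).
  by rewrite /radius y0 ?(ltW t0)// addrC mulNr.
rewrite /force_x clamp_id; last by rewrite (ltW dt') tr.
have y0' : y (2 * T - t) = 0 by apply: y0; rewrite (ltW (lt_trans d0 dt')) tr.
by rewrite /radius y0' addrC mulNr.
Qed.
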